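(* Let $n$ be a composite number, and write $n=qk$ where $q$ is a prime divisor of $n$. Let $m$ be a positive integer, and define $$F(x_0,\ldots,x_m)=x_0^{kq}+2(x_1^k+\cdots+x_m^k)^q\in\mathbb{Z}[x_0,\dots,x_m].$$ Then $\mathrm{o}(F)=m+1$, and there are infinitely many primes $p$ such that $R(F)$ is not dense in $\mathbb{Q}_p$.
   Context: For an integral form $F$ in $r$ variables, $R(F)=\{F(\overline{x})/F(\overline{y}) : \overline{x},\overline{y}\in\mathbb{Z}^r,\ F(\overline{y})\neq 0\}$, and density is in the $p$-adic topology. The order $\mathrm{o}(F)$ (over $\mathbb{Q}$) is the smallest integer $m'$ such that $F$ is equivalent, via an invertible linear change of variables over $\mathbb{Q}$, to a form explicitly involving only $m'$ variables. *)

(* Defs.v *)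
From HB Require Import structures.
From mathcomp Require Import all_boot all_order all_algebra.
From mathcomp Require Import mpoly.
Set Implicit Arguments. Unset Strict Implicit. Unset Printing Implicit Defensive.
Import Order.TTheory GRing.Theory Num.Theory.
Local Open Scope ring_scope.

Definition vp (p : nat) (x : rat) : int :=
  (logn p `|numq x|%N)%:Z - (logn p `|denq x|%N)%:Z.

(* A subset A of Q is dense in Q_p.  Since Q is dense in Q_p, this holds iff
   every rational r is a p-adic limit of elements of A, i.e. for every r and
   every e there is s in A with |s - r|_p <= p^-e. *)
Definition padic_dense (p : nat) (A : rat -> Prop) : Prop :=
  forall (r : rat) (e : nat), exists s, A s /\ (s = r \/ e%:Z <= vp p (s - r)).

Definition ratio_set (r : nat) (F : {mpoly int[r]}) (s : rat) : Prop :=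
  exists x y : 'I_r -> int,
    F.@[y] != 0 /\ s = (F.@[x])%:~R / (F.@[y])%:~R.

Definition linear_change (r : nat) (A : 'M[rat]_r) (G : {mpoly rat[r]})
  : {mpoly rat[r]} :=
  G \mPo [tuple \sum_(j < r) A i j *: 'X_j | i < r].

Definition involves_only (r : nat) (G : {mpoly rat[r]}) (S : {set 'I_r}) :=
  forall mon, mon \in msupp G -> forall i, i \notin S -> mon i = 0%N.

Definition equiv_form_in_vars (r : nat) (G : {mpoly rat[r]}) (m' : nat) :=
  exists A : 'M[rat]_r, A \in unitmx /\
    exists S : {set 'I_r}, #|S| = m' /\ involves_only (linear_change A G) S.

Definition order_is (r : nat) (F : {mpoly int[r]}) (k : nat) : Prop :=
  equiv_form_in_vars (map_mpoly (intr : int -> rat) F) k /\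
  forall j, equiv_form_in_vars (map_mpoly (intr : int -> rat) F) j -> (k <= j)%N.

Definition formF (m k q : nat) : {mpoly int[m.+1]} :=
  'X_ord0 ^+ (k * q) + 2%:R * (\sum_(i < m) 'X_(lift ord0 i) ^+ k) ^+ q.

(* Main.v *)
(* Write [F = A ^ q + 2 * B ^ q] with [A = x0 ^ k] and [B] the sum of the other
   [k]-th powers.  If [-2] is not a [q]-th power modulo [p], then [p] divides a
   value of [F] only if it divides both [A] and [B]; by descent the valuation of
   every nonzero value is a multiple of [q], and so is that of every nonzero
   quotient.  Hence [p] itself is not a limit of quotients.

   That there are infinitely many such [p] is shown without the Chebotarev
   theorem, by two counting arguments with the norm of [Z[T]/(f)].
   If [f] is irreducible of degree at least 2 and has a root modulo almost all
   primes, the number of pairs (n, root of [f] modulo n) with [n] of size [Z] is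
   [O(Z)] (pigeonhole and a norm estimate), which forces the sum of [1/p] over the
   primes with two roots to converge.  Conversely, for every irreducible [f] the
   sum of [1/p] over the primes with a root diverges: otherwise a sieve would
   produce, in a residue class that contains no unit, an element of [Z[T]/(f)]
   whose norm has no prime factor.  If [-2] were a [q]-th power modulo almost all [p], the
   first statement would apply to [T ^ q + 2], and its primes with two roots would
   include almost all primes at which the [q]-th cyclotomic polynomial has a root,
   against the second statement.

   For the order, an equivalence with a form in fewer variables gives a direction
   [v <> 0] along which [F] is constant, but the derivatives of [F] along [v] at
   the basis vectors recover the coordinates of [v]. *)

Require Import Defs.
From HB Require Import structures.
From mathcomp Require Import all_boot all_order all_fingroup all_algebra all_field.
From mathcomp Require Import mpoly.
From mathcomp Require Import zify ring lra.
From Stdlib Require Import Classical.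
Set Implicit Arguments. Unset Strict Implicit. Unset Printing Implicit Defensive.
Import Order.TTheory GRing.Theory Num.Theory.
Import Pdiv.RingMonic.
Local Open Scope ring_scope.

(** * The norm of [Z[T]/(f)] *)

(** Multiplication by [a] on [R[T]/(f)] in the power basis, for monic [f]. The dimension [d] is a
    separate argument, so that the matrix type is unchanged under a map of the coefficient ring. *)
Definition mulmod_mx (R : nzRingType) (d : nat) (f a : {poly R}) : 'M[R]_d :=
  \matrix_(i < d) poly_rV (Pdiv.Ring.rmodp ('X^i * a) f).

Definition norm_mod (R : comNzRingType) (d : nat) (f a : {poly R}) : R :=
  \det (mulmod_mx d f a).

Lemma map_rmodp (R S : nzRingType) (phi : {rmorphism R -> S}) (f p : {poly R}) :
  f \is monic ->
  map_poly phi (Pdiv.Ring.rmodp p f) =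
  Pdiv.Ring.rmodp (map_poly phi p) (map_poly phi f).
Proof.
move=> fm; have fm' : map_poly phi f \is monic by apply: monic_map.
rewrite [X in Pdiv.Ring.rmodp (map_poly phi X) _](rdivp_eq fm p).
rewrite rmorphD rmorphM /= rmodp_addl_mul_small //.
rewrite (size_map_poly_id0 (p := f)); last by rewrite (monicP fm) rmorph1 oner_eq0.
apply: leq_ltn_trans (size_poly _ _) _.
by rewrite Pdiv.Ring.ltn_rmodpN0 // monic_neq0.
Qed.

Lemma map_norm_mod (R S : comNzRingType) (phi : {rmorphism R -> S}) d
    (f a : {poly R}) :
  f \is monic ->
  phi (norm_mod d f a) = norm_mod d (map_poly phi f) (map_poly phi a).
Proof.
move=> fm; rewrite /norm_mod -det_map_mx; congr (\det _).
apply/matrixP=> i j; rewrite !mxE -coef_map /=.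
by rewrite map_rmodp // rmorphM /= map_polyXn.
Qed.

Lemma norm_mod_const (R : comNzRingType) (f : {poly R}) d (u : R) :
  f \is monic -> size f = d.+1 -> norm_mod d f u%:P = u ^+ d.
Proof.
move=> fm sf; rewrite /norm_mod (_ : mulmod_mx d f u%:P = u%:M) ?det_scalar //.
apply/matrixP=> i j; rewrite !mxE Pdiv.Ring.rmodp_small.
  by rewrite coefMC coefXn -[in RHS]val_eqE /= eq_sym; case: eqP; rewrite ?mul1r ?mul0r.
rewrite mulrC mul_polyC sf ltnS; apply: leq_trans (size_scale_leq _ _) _.
by rewrite size_polyXn.
Qed.

(** A nonzero vector in the left kernel is a polynomial [u] of degree below [d] with [f] dividing
    [u * a]; by coprimality [f] would divide [u]. *)
Lemma norm_mod_neq0 (F : fieldType) (f a : {poly F}) d :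
  f \is monic -> size f = d.+1 -> coprimep f a -> norm_mod d f a != 0.
Proof.
move=> fm sf cop; rewrite /norm_mod; apply/negP=> /det0P[v v0 vM].
pose u := rVpoly v.
have u0 : u != 0.
  apply: contraNneq v0 => u0; rewrite -[v]rVpolyK -/u u0.
  by rewrite linear0.
have: poly_rV (Pdiv.Ring.rmodp (u * a) f) = 0 :> 'rV_d.
  rewrite -vM /u {1}/rVpoly poly_def mulr_suml rmodp_sum // linear_sum /=.
  apply/matrixP=> i j; rewrite ord1 !mxE summxE; apply: eq_bigr => k _.
  rewrite !mxE /= valK -scalerAl rmodpZ // coefZ; congr (_ * _).
move/(congr1 rVpoly); rewrite linear0 poly_rV_K; last first.
  by rewrite -ltnS -sf Pdiv.Ring.ltn_rmodpN0 // monic_neq0.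
move=> /eqP ra0; have: f %| u * a by rewrite dvdpE /Pdiv.Ring.rdvdp.
rewrite mulrC Gauss_dvdpr // => /dvdp_leq; rewrite u0 sf => /(_ isT).
by rewrite ltnNge size_poly.
Qed.

Lemma det_norm_le (n : nat) (M : 'M[int]_n) (B : int) :
  (forall i j, `|M i j| <= B) -> `|\det M| <= n`!%:Z * B ^+ n.
Proof.
move=> leB; rewrite /determinant.
apply: le_trans (ler_norm_sum _ _ _) _.
apply: le_trans (ler_sum (G := fun=> B ^+ n) _ _) _.
  move=> s _; rewrite normrM normrX normrN1 expr1n mul1r normr_prod.
  rewrite -[X in _ ^+ X](card_ord n) -prodr_const.
  by apply: ler_prod => i _; rewrite normr_ge0 leB.
have cardS : #|{perm 'I_n}| = n`! by rewrite -card_Sn; apply: eq_card.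
by rewrite sumr_const cardS -mulr_natl natz lexx.
Qed.

Lemma norm_mod_le (f : {poly int}) d :
  f \is monic -> size f = d.+1 ->
  exists2 C : nat, (0 < C)%N & forall (a : {poly int}) (B : nat),
    (size a <= d)%N -> (forall i, (absz (a`_i)%R <= B)%N) ->
    (absz (norm_mod d f a) <= C * B ^ d)%N.
Proof.
move=> fm sf.
(* [K] sums the absolute values of all structure constants of the power basis, so every entry of the
   matrix is at most [K * B] in absolute value. *)
pose K := (\sum_(i < d) \sum_(j < d) \sum_(l < d)
   absz ((Pdiv.Ring.rmodp ('X^i * 'X^l) f)`_j)%R)%N.
exists (d`! * K ^ d).+1 => // a B sa leB.
suff: `|norm_mod d f a| <= d`!%:Z * (K * B)%:Z ^+ d.
  have -> : d`!%:Z * (K * B)%:Z ^+ d = (d`! * (K * B) ^ d)%N.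
    by rewrite [RHS]PoszM -[((K * B) ^ d)%N%:Z]natz natrX natz.
  rewrite -abszE lez_nat expnMn mulnA => le; apply: leq_trans le _.
  by rewrite leq_mul2r leqnSn orbT.
apply: det_norm_le => i j; rewrite !mxE.
have -> : a = \sum_(l < d) a`_l *: 'X^l.
  rewrite -poly_def; apply/polyP=> l; rewrite coef_poly; case: ltnP => // le.
  by rewrite nth_default // (leq_trans sa).
rewrite mulr_sumr rmodp_sum // coef_sum.
apply: le_trans (ler_norm_sum _ _ _) _.
have -> : (K * B)%:Z = K%:Z * B%:Z by [].
apply: le_trans (_ : \sum_(l < d) `|(Pdiv.Ring.rmodp ('X^i * 'X^l) f)`_j| * B%:Z <= _).
  apply: ler_sum => l _; rewrite -scalerAr rmodpZ // coefZ normrM mulrC.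
  by rewrite ler_wpM2l // -abszE lez_nat.
rewrite -mulr_suml ler_wpM2r //.
rewrite (_ : \sum_(l < d) _ = (\sum_(l < d)
   absz ((Pdiv.Ring.rmodp ('X^i * 'X^l) f)`_j)%R)%N%:Z); last first.
  by rewrite -natz natr_sum; apply: eq_bigr => l _; rewrite natz.
rewrite lez_nat /K [leqRHS](bigD1 i) //= [X in (_ <= X + _)%N](bigD1 j) //= -addnA.
exact: leq_addr.
Qed.

(** Both [f] and [a] lie in the ideal [(g, n)], hence so does every row of the multiplication
    matrix. The polynomials of degree below [d] in this ideal form a lattice with the triangular
    basis [n X^k] for [k < e], [g X^k] for [k < d - e]; its determinant [n^e] divides the norm. *)
Lemma norm_mod_dvd (d e : nat) (n : int) (f g a uf vf ua va : {poly int}) :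
  f \is monic -> size f = d.+1 -> g \is monic -> size g = e.+1 -> (e <= d)%N ->
  f = uf * g + n *: vf -> a = ua * g + n *: va ->
  (n ^+ e %| norm_mod d f a)%Z.
Proof.
move=> fm sf gm sg led fE aE.
have [r dE] : {r | d = (e + r)%N} by exists (d - e)%N; rewrite subnKC.
subst d.
pose b i : {poly int} := Pdiv.Ring.rmodp ('X^i * a) f.
pose q i : {poly int} := Pdiv.Ring.rdivp ('X^i * a) f.
pose w i : {poly int} := 'X^i * va - q i * vf.
pose v i : {poly int} := Pdiv.Ring.rmodp (w i) g.
pose s i : {poly int} := 'X^i * ua - q i * uf + n *: Pdiv.Ring.rdivp (w i) g.
have sv i : (size (v i) <= e)%N.
  by rewrite -ltnS -sg Pdiv.Ring.ltn_rmodpN0 // monic_neq0.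
have bE i : b i = s i * g + n *: v i.
  have -> : b i = 'X^i * a - q i * f.
    by rewrite {1}(rdivp_eq fm ('X^i * a)) addrC addKr.
  have wE := rdivp_eq gm (w i); rewrite -/(v i) in wE.
  rewrite aE fE /s; move: wE; rewrite /w -!mul_polyC => wE.
  have -> : n%:P * v i = n%:P * (('X^i * va - q i * vf) - Pdiv.Ring.rdivp (w i) g * g).
    by rewrite {1}wE; ring.
  by ring.
have sb i : (size (b i) <= e + r)%N.
  by rewrite -ltnS -sf Pdiv.Ring.ltn_rmodpN0 // monic_neq0.
have ss i : (size (s i) <= r)%N.
  have [->|s0] := eqVneq (s i) 0; first by rewrite size_poly0.
  have: (size (s i * g)%R <= e + r)%N.
    have -> : s i * g = b i - n *: v i by rewrite bE addrK.
    apply: leq_trans (size_polyD _ _) _; rewrite geq_max sb size_polyN.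
    by apply: leq_trans (size_scale_leq _ _) _; rewrite (leq_trans (sv i)) ?leq_addr.
  by rewrite size_Mmonic // sg; lia.
pose Bp (j : 'I_(e + r)) : {poly int} := match split j with
  | inl k => n *: 'X^k | inr k => g * 'X^k end.
pose B : 'M[int]_(e + r) := \matrix_j poly_rV (Bp j).
pose X : 'M[int]_(e + r) := \matrix_(i, j) match split j with
  | inl k => (v i)`_k | inr k => (s i)`_k end.
have polyE m (p : {poly int}) : (size p <= m)%N -> p = \sum_(l < m) p`_l *: 'X^l.
  move=> sp; rewrite -poly_def; apply/polyP=> l; rewrite coef_poly.
  by case: ltnP => // le; rewrite nth_default // (leq_trans sp).
have -> : norm_mod (e + r) f a = \det X * \det B.
  rewrite -det_mulmx; congr (\det _); apply/matrixP=> i j; rewrite !mxE -/(b i).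
  transitivity ((\sum_k X i k *: Bp k)`_j); last first.
    by rewrite coef_sum; apply: eq_bigr => k _; rewrite coefZ !mxE.
  rewrite bE [s i * g + _]addrC; congr (nth 0 (polyseq _) _).
  rewrite big_split_ord /=; congr (_ + _).
    rewrite {1}(polyE _ _ (sv i)) scaler_sumr; apply: eq_bigr => k _.
    rewrite !mxE /Bp; case: splitP => [k' /= /val_inj <-|k' /= kE]; last first.
      by have := ltn_ord k; rewrite kE; lia.
    by rewrite !scalerA mulrC.
  rewrite {1}(polyE _ _ (ss i)) mulr_suml; apply: eq_bigr => k _.
  rewrite !mxE /Bp; case: splitP => [k' /= kE|k' /= /addnI /val_inj <-].
    by have := ltn_ord k'; rewrite -kE; lia.
  by rewrite -scalerAl mulrC.
rewrite (det_trig (A := B)); last first.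
  apply/is_trig_mxP=> i j ij; rewrite !mxE /Bp; case: splitP => k iE.
    by rewrite coefZ coefXn -iE gtn_eqF // mulr0.
  rewrite coefMXn iE in ij *; have -> : (j < k)%N = false by lia.
  by rewrite nth_default // sg; lia.
rewrite big_split_ord /= (eq_bigr (fun=> n)) => [|k _]; last first.
  rewrite !mxE /Bp; case: splitP => [k' /= /val_inj <-|k' /= kE]; last first.
    by have := ltn_ord k; rewrite kE; lia.
  by rewrite coefZ coefXn eqxx mulr1.
rewrite big_const_ord -Monoid.iteropE /= -/(n ^+ e) mulrCA dvdz_mulr //.
Qed.

Lemma intr_Fp_eq0 (p : nat) (n : int) :
  prime p -> (n%:~R == 0 :> 'F_p) = (p %| n)%Z.
Proof. by move=> pp; rewrite -(dvdz_pcharf (pchar_Fp pp)). Qed.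

Lemma map_poly_Fp_eq0 (p : nat) (h : {poly int}) :
  prime p -> map_poly intr h = 0 :> {poly 'F_p} -> exists v, h = p%:Z *: v.
Proof.
move=> pp h0; apply/polyOver_dvdzP/polyOverP => i.
have /polyP/(_ i)/eqP := h0; rewrite coef_map coef0 /= intr_Fp_eq0 //.
Qed.

Definition lift_Fp (p : nat) (g : {poly 'F_p}) : {poly int} :=
  map_poly (fun x : 'F_p => (x : nat)%:Z) g.

Lemma lift_FpK (p : nat) (g : {poly 'F_p}) : map_poly intr (lift_Fp g) = g.
Proof.
apply/polyP=> i; rewrite coef_map coef_map_id0 //=.
by rewrite -[RHS](natr_Zp g`_i).
Qed.

Lemma size_lift_Fp (p : nat) (g : {poly 'F_p}) : size (lift_Fp g) = size g.
Proof.
have [->|g0] := eqVneq g 0; first by rewrite /lift_Fp map_poly0 ?size_poly0.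
rewrite -lead_coef_eq0 in g0; rewrite /lift_Fp size_map_poly_id0 //.
Qed.

Lemma lift_Fp_monic (p : nat) (g : {poly 'F_p}) :
  prime p -> g \is monic -> lift_Fp g \is monic.
Proof.
move=> pp; rewrite !monicE !lead_coefE size_lift_Fp coef_map_id0 // => /eqP->.
Qed.

Definition has_root_Fp (f : {poly int}) (p : nat) : bool :=
  [exists x : 'F_p, root (map_poly intr f) x].

(** The classes correspond to the roots of [f] in a splitting field over ['F_p]: class [j] holds the
    polynomials that vanish at the [j]-th root. A member of a class shares a factor with [f] modulo
    [p], and this factor has degree at least 2 when [f] has no root in ['F_p]. *)
Lemma norm_mod_classes (f : {poly int}) (d p : nat) :
  f \is monic -> size f = d.+1 -> prime p ->
  exists K : 'I_d -> pred {poly int}, [/\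
    forall a, (p %| norm_mod d f a)%Z -> exists j, K j a,
    forall j a b, K j a -> K j b -> K j (a - b),
    forall j c b, ~~ (p %| c)%Z -> K j (c *: b) -> K j b
  & forall j b, K j b ->
      (p%:Z ^+ (if has_root_Fp f p then 1 else 2)%N %| norm_mod d f b)%Z].
Proof.
move=> fm sf pp; pose phi := map_poly intr : {poly int} -> {poly 'F_p}.
have fm' : phi f \is monic by apply: monic_map.
have sf' : size (phi f) = d.+1.
  by rewrite size_map_poly_id0 // (monicP fm) rmorph1 oner_eq0.
have [E [rs Drs _]] := FinSplittingFieldFor (monic_neq0 fm').
have srs : size rs = d.
  by have := eqp_size Drs; rewrite size_prod_XsubC size_map_poly sf' => -[].
exists (fun j b => root (map_poly (in_alg E) (phi b)) rs`_j); split.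
- move=> a pa.
  have: ~~ coprimep (phi f) (phi a).
    apply/negP=> /(norm_mod_neq0 fm' sf'); apply/negP; rewrite negbK.
    by rewrite -(map_norm_mod _ _ _ fm) intr_Fp_eq0.
  rewrite /coprimep => sg.
  have: map_poly (in_alg E) (gcdp (phi f) (phi a)) %|
        \prod_(z <- rs) ('X - z%:P).
    by rewrite -(eqp_dvdr _ Drs) dvdp_map dvdp_gcdl.
  move=> /dvdp_prod_XsubC[m Dm].
  have := eqp_size Dm; rewrite size_prod_XsubC size_map_poly => sm.
  have [z zm] : exists z, z \in mask m rs.
    by case: (mask m rs) sm sg => [->//|z s _ _]; exists z; rewrite mem_head.
  have zr := mem_mask zm.
  have jd : (index z rs < d)%N by rewrite -srs index_mem.
  exists (Ordinal jd); rewrite /= nth_index //.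
  have: root (map_poly (in_alg E) (gcdp (phi f) (phi a))) z.
    by rewrite (eqp_root Dm) root_prod_XsubC.
  by rewrite gcdp_map root_gcd => /andP[].
- move=> j a b; rewrite /phi !rmorphB /= !rootE !hornerE.
  by move=> /eqP-> /eqP->; rewrite subrr.
- move=> j c b pc; rewrite /phi map_polyZ /= map_polyZ /= rootE hornerZ mulf_eq0.
  by rewrite scaler_eq0 oner_eq0 orbF intr_Fp_eq0 // (negPf pc).
move=> j b rb; pose g0 := gcdp (phi f) (phi b).
have g00 : g0 != 0 by rewrite gcdp_eq0 (negPf (monic_neq0 fm')).
(* The gcd is made monic so that its integer lift can be used in [norm_mod_dvd]. *)
pose g := (lead_coef g0)^-1 *: g0.
have gm : g \is monic by rewrite monicE lead_coefZ mulVf // lead_coef_eq0.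
have sg : size g = size g0 by rewrite size_scale // invr_eq0 lead_coef_eq0.
have gE : g %= g0 by apply: eqp_scale; rewrite invr_eq0 lead_coef_eq0.
have /dvdpP[u fE] : g %| phi f by rewrite (eqp_dvdl _ gE) dvdp_gcdl.
have /dvdpP[w bE] : g %| phi b by rewrite (eqp_dvdl _ gE) dvdp_gcdr.
have sg1 : (1 < size g)%N.
  rewrite sg -(size_map_poly (in_alg E)).
  apply: (@root_size_gt1 _ rs`_j); first by rewrite map_poly_eq0.
  rewrite gcdp_map root_gcd rb andbT (eqp_root Drs) root_prod_XsubC mem_nth //.
  by rewrite srs.
have [e se] : exists e, size g = e.+2 by case: (size g) sg1 => [|[|e]] // _; exists e.
have sgd : (e.+1 <= d)%N.
  rewrite -ltnS -sf' -se dvdp_leq ?monic_neq0 //.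
  by rewrite fE dvdp_mull.
have e1 : ((if has_root_Fp f p then 1 else 2) <= e.+1)%N.
  case: ifP => // /negbT/negP nr; case: e se {sgd} => // se.
  have [x gx] := poly2_root se; case: nr; rewrite /has_root_Fp; apply/existsP; exists x.
  by rewrite -/(phi f) fE rootM gx orbT.
have [v fE'] : exists v, f - lift_Fp u * lift_Fp g = p%:Z *: v.
  by apply: map_poly_Fp_eq0; rewrite // rmorphB rmorphM /= !lift_FpK -/(phi f) fE subrr.
have [v' bE'] : exists v, b - lift_Fp w * lift_Fp g = p%:Z *: v.
  by apply: map_poly_Fp_eq0; rewrite // rmorphB rmorphM /= !lift_FpK -/(phi b) bE subrr.
apply: (dvdz_trans (dvdz_exp2l _ e1)).
apply: (norm_mod_dvd fm sf (lift_Fp_monic pp gm) _ sgd (uf := lift_Fp u)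
  (ua := lift_Fp w) (vf := v) (va := v')); rewrite ?size_lift_Fp //.
- by rewrite -fE' addrC subrK.
- by rewrite -bE' addrC subrK.
Qed.

(** By Gauss's lemma [f] stays irreducible over the rationals, so it is coprime to every nonzero
    polynomial of smaller degree. *)
Lemma norm_mod_int_neq0 (f a : {poly int}) (d : nat) :
  f \is monic -> size f = d.+1 -> irreducible_poly f ->
  a != 0 -> (size a <= d)%N -> norm_mod d f a != 0.
Proof.
move=> fm sf /irreducible_rat_int irr a0 sa.
have fm' : map_poly (intr : int -> rat) f \is monic by apply: monic_map.
have sz (b : {poly int}) : size (map_poly (intr : int -> rat) b) = size b.
  by rewrite size_map_inj_poly //; apply: intr_inj.
rewrite -(intr_eq0 rat) (map_norm_mod (intr : {rmorphism int -> rat})) //.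
apply: norm_mod_neq0; rewrite ?sz //.
rewrite irreducible_poly_coprime //; apply/negP=> /dvdp_leq.
by rewrite -size_poly_eq0 sz size_poly_eq0 !sz sf => /(_ a0); rewrite ltnNge sa.
Qed.

Lemma poly_mod_root (a : {poly int}) (n r : int) :
  (n %| a.[r])%Z -> exists u v, a = u * ('X - r%:P) + n *: v.
Proof.
move=> /dvdzP[c cE]; have: root (a - a.[r]%:P) r by rewrite /root !hornerE subrr.
case/factor_theorem=> u uE; exists u, c%:P.
by rewrite -uE -mul_polyC -polyCM mulrC -cE subrK.
Qed.

(** After division by [X - r], the quotient [u] satisfies [u(s) (s - r) = a(s)] modulo [n], where
    [s - r] is invertible. *)
Lemma poly_mod_root2 (a : {poly int}) (n r s : int) : coprimez n (s - r) ->
  (n %| a.[r])%Z -> (n %| a.[s])%Z ->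
  exists u v, a = u * (('X - r%:P) * ('X - s%:P)) + n *: v.
Proof.
move=> cop /poly_mod_root[u [v aE]] ns.
have: (n %| u.[s])%Z.
  rewrite -(Gauss_dvdzl _ cop).
  have -> : u.[s] * (s - r) = a.[s] - n * v.[s] by rewrite aE !hornerE; ring.
  by rewrite rpredB // dvdz_mulr.
case/poly_mod_root=> u' [v' uE]; exists u', (v' * ('X - r%:P) + v).
by rewrite aE uE -!mul_polyC; ring.
Qed.

Lemma norm_mod_root (f a : {poly int}) d (n r : int) :
  f \is monic -> size f = d.+1 -> (0 < d)%N ->
  (n %| f.[r])%Z -> (n %| a.[r])%Z -> (n %| norm_mod d f a)%Z.
Proof.
move=> fm sf d0 /poly_mod_root[u [v fE]] /poly_mod_root[u' [v' aE]].
rewrite -[n]expr1.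
exact: (norm_mod_dvd fm sf (monicXsubC r) (size_XsubC r) d0 fE aE).
Qed.

Lemma norm_mod_root2 (f a : {poly int}) d (n r s : int) :
  f \is monic -> size f = d.+1 -> (1 < d)%N -> coprimez n (s - r) ->
  (n %| f.[r])%Z -> (n %| f.[s])%Z -> (n %| a.[r])%Z -> (n %| a.[s])%Z ->
  (n ^+ 2 %| norm_mod d f a)%Z.
Proof.
move=> fm sf d1 cop fr fs ar as_.
have [u [v fE]] := poly_mod_root2 cop fr fs.
have [u' [v' aE]] := poly_mod_root2 cop ar as_.
apply: (norm_mod_dvd fm sf _ _ d1 fE aE).
  by rewrite rpredM ?monicXsubC.
by rewrite size_Mmonic ?monicXsubC ?polyXsubC_eq0 // !size_XsubC.
Qed.

(** Take the largest [s] with [C * s ^ d < W]; its successor is at most [2 * s]. *)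
Lemma dyadic_root (C W d : nat) : (0 < d)%N -> (0 < C)%N -> (C < W)%N ->
  exists s, [/\ (0 < s)%N, (C * s ^ d < W)%N & (W <= C * (2 * s) ^ d)%N].
Proof.
move=> d0 C0 CW.
pose P s := (C * s.+1 ^ d < W)%N.
have exP : exists s, P s by exists 0; rewrite /P exp1n muln1.
have ubP s : P s -> (s <= W)%N.
  move=> Ps; apply: leq_trans (ltnW Ps).
  apply: leq_trans (leqnSn _) _; apply: leq_trans (leq_pmull _ C0).
  by case: d d0 {P exP Ps} => // d _; rewrite expnS leq_pmulr // expn_gt0.
case: (ex_maxnP exP ubP) => s Ps maxs; exists s.+1; split=> //.
have : ~~ P s.+1 by apply/negP=> /maxs; rewrite ltnn.
rewrite /P -leqNgt => le; apply: leq_trans le _.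
by rewrite leq_pmul2l // leq_exp2r //; lia.
Qed.

(* Points with the same integer part after division by [s] are too close to
   be distinct when [C * s ^ d < W]. *)
Lemma card_separated (d X Y C W : nat) (A : {set {ffun 'I_d -> 'I_X}}) :
  (0 < d)%N -> (0 < C)%N -> (C < W)%N -> (X <= Y)%N -> (W <= C * Y ^ d)%N ->
  (forall (c c' : {ffun 'I_d -> 'I_X}) s, c \in A -> c' \in A -> c != c' ->
     (forall i, (`|(c i)%:Z - (c' i)%:Z| <= s)%N) -> (W <= C * s ^ d)%N) ->
  (#|A| * W <= C * 4 ^ d * Y ^ d)%N.
Proof.
move=> d0 C0 CW XY WY sep.
have [s [s0 sW Ws]] := dyadic_root d0 C0 CW.
have sY : (s < Y)%N.
  have: (C * s ^ d < C * Y ^ d)%N by apply: leq_trans WY.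
  by rewrite ltn_pmul2l // ltn_exp2r.
pose M := ((X.-1) %/ s).+1.
pose g (c : {ffun 'I_d -> 'I_X}) : {ffun 'I_d -> 'I_M} :=
  [ffun i => inord (c i %/ s)].
have ginj : {in A &, injective g}.
  move=> c c' cA cA' /ffunP gE; apply/eqP/negP=> /negP ne.
  suff: (W <= C * s ^ d)%N by rewrite leqNgt sW.
  apply: (sep c c' s cA cA' ne) => i.
  have lt (c1 : {ffun 'I_d -> 'I_X}) : (c1 i %/ s < M)%N.
    by rewrite ltnS leq_div2r //; have := ltn_ord (c1 i); lia.
  have := gE i; rewrite !ffunE => /(congr1 val) /=; rewrite !inordK // => e.
  have := divn_eq (c i) s; have := divn_eq (c' i) s; rewrite e.
  have := ltn_pmod (c i) s0; have := ltn_pmod (c' i) s0; lia.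
have cardA : (#|A| <= M ^ d)%N.
  rewrite -(card_in_imset ginj); apply: leq_trans (max_card _) _.
  by rewrite card_ffun !card_ord.
have Ms : (M * s <= 2 * Y)%N.
  rewrite mulSn; have := leq_trunc_div X.-1 s; lia.
(* One factor [2 ^ d] comes from the doubling of [s], the other from [M * s <= 2 * Y]. *)
apply: leq_trans (leq_mul cardA Ws) _.
rewrite expnMn mulnCA -mulnA leq_pmul2l // mulnCA -expnMn.
have -> : (4 ^ d = 2 ^ d * 2 ^ d)%N by rewrite -expnMn.
by rewrite -mulnA leq_pmul2l ?expn_gt0 // -expnMn leq_exp2r.
Qed.

(** * Divergence over the primes with a root *)

Definition coef_poly_int (d : nat) (c : 'I_d -> int) : {poly int} :=
  rVpoly (\row_i c i).

Lemma size_coef_poly_int d (c : 'I_d -> int) : (size (coef_poly_int c) <= d)%N.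
Proof. exact: size_poly. Qed.

Lemma coef_poly_intE d (c : 'I_d -> int) (i : 'I_d) : (coef_poly_int c)`_i = c i.
Proof. by rewrite coef_rVpoly_ord mxE. Qed.

Lemma coef_poly_int_le d (c : 'I_d -> int) (B : nat) (i : nat) :
  (forall i, (`|c i| <= B)%N) -> (absz ((coef_poly_int c)`_i)%R <= B)%N.
Proof.
move=> cB; rewrite coef_rVpoly; case: insubP => [j _ _|_]; first by rewrite mxE.
by rewrite absz0.
Qed.

Lemma coef_poly_int_eq0 d (c : 'I_d -> int) :
  coef_poly_int c = 0 -> forall i, c i = 0.
Proof. by move=> c0 i; rewrite -coef_poly_intE c0 coef0. Qed.

Lemma coef_poly_intB d (c c' : 'I_d -> int) :
  coef_poly_int c - coef_poly_int c' = coef_poly_int (fun i => c i - c' i).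
Proof.
rewrite /coef_poly_int -linearB; congr rVpoly.
by apply/rowP=> i; rewrite !mxE.
Qed.

Lemma union_bound (T : finType) (I : Type) (L : seq I) (A : I -> {set T}) :
  (forall c, has (fun i => c \in A i) L) -> (#|T| <= \sum_(i <- L) #|A i|)%N.
Proof.
move=> cov; under eq_bigr => i _ do rewrite -sum1_card big_mkcond /=.
rewrite exchange_big /= -sum1_card; apply: leq_sum => c _.
have := cov c; elim: L {cov} => //= i L IH; rewrite big_cons.
by case: (c \in A i) => //= /IH.
Qed.

(** Cauchy's criterion in place of a limit, since [rat] is not complete; finite sets are
    duplicate-free lists. *)
Definition summable_tail (Q : pred nat) (w : nat -> rat) : Prop :=
  forall eps : rat, 0 < eps -> exists P : nat, forall S : seq nat,
    uniq S -> (forall p, p \in S -> Q p /\ (P < p)%N) ->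
    \sum_(p <- S) w p <= eps.

(* The exponent is a lower bound for the residue degrees of the primes above
   [p] that can contain an element whose norm is divisible by [p]. *)
Definition residue_card (f : {poly int}) (p : nat) : nat :=
  (p ^ (if has_root_Fp f p then 1 else 2))%N.

Lemma residue_card_gt0 f p : (0 < p)%N -> (0 < residue_card f p)%N.
Proof. by move=> p0; rewrite expn_gt0 p0. Qed.

(** The vectors with [p] dividing the norm fall into [d] classes. Two vectors of one class have a
    difference whose norm is nonzero and divisible by [residue_card f p], so they are far apart and
    [card_separated] bounds each class. The side [Y] may exceed the side [X] of the box, to admit
    primes that are large compared with the box. *)
Lemma card_norm_dvd (f : {poly int}) (d C0 u D X Y p : nat) :
  f \is monic -> size f = d.+1 -> irreducible_poly f -> (0 < d)%N ->
  (0 < C0)%N ->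
  (forall (a : {poly int}) (B : nat), (size a <= d)%N ->
    (forall i, (absz (a`_i)%R <= B)%N) -> (absz (norm_mod d f a) <= C0 * B ^ d)%N) ->
  prime p -> (C0 < p)%N -> ~~ (p %| D)%N -> (X <= Y)%N ->
  let a (c : {ffun 'I_d -> 'I_X}) :=
    u%:Z%:P + D%:Z *: coef_poly_int (fun i => (c i)%:Z) in
  let A := [set c | (p %| norm_mod d f (a c))%Z] in
  ((residue_card f p <= C0 * Y ^ d)%N ->
    (#|A| * residue_card f p <= d * (C0 * 4 ^ d * Y ^ d))%N) /\
  (forall c, c \in A -> ((residue_card f p)%:Z %| norm_mod d f (a c))%Z).
Proof.
move=> fm sf irr d0 C0p bnd pp C0ltp pD XY a A.
have [K [Kex KB KZ Kdvd]] := norm_mod_classes fm sf pp.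
have Wexp : p%:Z ^+ (if has_root_Fp f p then 1 else 2)%N = residue_card f p.
  by rewrite -[in RHS]natz natrX natz.
rewrite {}Wexp in Kdvd; set W := residue_card f p in Kdvd *.
split; last by move=> c; rewrite inE => /Kex[j] /Kdvd.
move=> WY; pose Aj j := [set c | K j (a c)].
have AjW j : (#|Aj j| * W <= C0 * 4 ^ d * Y ^ d)%N.
  apply: (card_separated d0 C0p _ XY WY).
    apply: leq_trans C0ltp _; rewrite /W /residue_card.
    by case: ifP => _; rewrite ?expn1 // leq_pmulr // prime_gt0.
  move=> c c' s; rewrite !inE => Kc Kc' ne le.
  have aB : a c - a c' =
      D%:Z *: coef_poly_int (fun i => (c i)%:Z - (c' i)%:Z).
    by rewrite -coef_poly_intB scalerBr /a opprD addrACA subrr add0r.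
  have := KB _ _ _ Kc Kc'; rewrite aB => /KZ; rewrite dvdzE /= => /(_ pD) /Kdvd.
  rewrite dvdzE => /dvdn_leq h; apply: leq_trans (h _) _.
    rewrite absz_gt0 norm_mod_int_neq0 ?size_coef_poly_int //.
    apply: contraNneq ne => e0; apply/eqP/ffunP=> i; apply: val_inj.
    by have /eqP := coef_poly_int_eq0 e0 i; rewrite subr_eq0 => /eqP[].
  apply: bnd; first exact: size_coef_poly_int.
  by move=> i; apply: coef_poly_int_le.
apply: (@leq_trans ((\sum_j #|Aj j|) * W)).
  rewrite leq_mul2r; apply/orP; right.
  apply: (@leq_trans #|\bigcup_j Aj j|).
    apply/subset_leq_card/subsetP=> c; rewrite inE => /Kex[j Kj].
    by apply/bigcupP; exists j; rewrite ?inE.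
  elim/big_rec2: _ => [|j n B _ IH]; first by rewrite cards0.
  by apply: leq_trans (leq_card_setU _ _) _; rewrite leq_add2l.
rewrite big_distrl /=; apply: leq_trans (leq_sum _ (fun j _ => AjW j)) _.
by rewrite sum_nat_const card_ord.
Qed.

Lemma prime_dvd_fact (p n : nat) : prime p -> (p %| n`!)%N -> (p <= n)%N.
Proof.
move=> pp; elim: n => [|n IH]; first by rewrite fact0 Euclid_dvd1.
rewrite factS Euclid_dvdM // => /orP[/dvdn_leq -> //|/IH /leqW //].
Qed.

(* The point is that [(1 + E) ^ d] is a unit modulo [D] that is different from
   [1] and [-1], so that an integer congruent to it must have a prime factor,
   and this factor does not divide [E]. *)
Lemma prime_factor_of_congruence (d P : nat) (N : int) :
  (0 < d)%N -> (2 <= P)%N ->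
  (((P`!) ^ (2 * d).+1)%N %| N - ((P`!).+1 ^ d)%N%:Z)%Z ->
  exists p, [/\ prime p, (P < p)%N & (p %| N)%Z].
Proof.
move=> d0 P2; set E := P`!; set u := E.+1; set D := (E ^ (2 * d).+1)%N => DN.
have E2 : (2 <= E)%N by rewrite /E (leq_trans P2) // fact_geq.
(* A prime up to [P] divides [E], hence [D], and would divide [(E + 1) ^ d]. *)
have big p : prime p -> (p %| N)%Z -> (P < p)%N.
  move=> pp pN; rewrite ltnNge; apply/negP=> pP.
  have pE : (p %| E)%N by rewrite dvdn_fact // prime_gt0.
  have pD : (p %| D)%N by rewrite /D expnS dvdn_mulr.
  have: (p %| (u ^ d)%N%:Z)%Z.
    have -> : (u ^ d)%N%:Z = N - (N - (u ^ d)%N%:Z) by rewrite opprB addrC subrK.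
    by rewrite rpredB // (dvdz_trans _ DN).
  rewrite dvdzE /= Euclid_dvdX // => /andP[+ _].
  by rewrite /u -addn1 dvdn_addr // Euclid_dvd1.
have N0 : N != 0.
  by apply/eqP=> N0; have := big 2 isT; rewrite N0 dvdz0 => /(_ isT); lia.
have uD : (1 < u ^ d)%N by rewrite -{1}(exp1n d) ltn_exp2r // /u; lia.
(* As [u <= E ^ 2], the exponent [2 * d + 1] makes [D] larger than [u ^ d + 1], so [N] can be
   neither [1] nor [-1]. *)
have Du : ((u ^ d).+1 < D)%N.
  have h1 : (u ^ d <= E ^ (2 * d))%N.
    rewrite expnM leq_exp2r // /u; nia.
  have h2 : (1 < E ^ (2 * d))%N by rewrite -{1}(exp1n (2 * d)) ltn_exp2r //; lia.
  rewrite /D expnS; nia.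
have N1 : (1 < `|N|)%N.
  suff : `|N|%N <> 1%N by have : (0 < `|N|)%N by [rewrite absz_gt0]; lia.
  move=> N1; have : (D %| `|N - (u ^ d)%N%:Z|)%N by rewrite -(dvdzE D%:Z).
  move=> /dvdn_leq; lia.
exists (pdiv `|N|); rewrite pdiv_prime // dvdzE pdiv_dvd; split=> //.
by apply: big; rewrite ?pdiv_prime // dvdzE pdiv_dvd.
Qed.

Lemma intr_Zp_eq0 (n : nat) (m : int) :
  (1 < n)%N -> m%:~R = 0 :> 'Z_n -> (n %| m)%Z.
Proof.
move=> n1 m0; have: (`|m|%N%:R : 'Z_n) = 0.
  by case: m m0 => m //=; rewrite NegzE mulrNz => /eqP; rewrite oppr_eq0 => /eqP.
by move/(congr1 val) => /=; rewrite val_Zp_nat // dvdzE => /eqP.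
Qed.

(** Take the elements [u + D * c] with [c] in a box of side [X]. Their norms are congruent to
    [u ^ d] modulo [D], so each has a prime factor above [P0], and the sets [A p] with [p > P0]
    cover the box. If the series converged, these sets would fill at most half of it. *)
Lemma residue_card_not_summable (f : {poly int}) (d : nat) :
  f \is monic -> size f = d.+1 -> irreducible_poly f -> (0 < d)%N ->
  ~ summable_tail prime (fun p => ((residue_card f p)%:R)^-1).
Proof.
move=> fm sf irr d0 tail.
have [C0 C0p bnd] := norm_mod_le fm sf.
pose C := (d * (C0 * 4 ^ d))%N.
have Cp : (0 < C)%N by rewrite !muln_gt0 d0 C0p expn_gt0.
have CQ : 0 < C%:R :> rat by rewrite ltr0n.
(* Two tails are cut. The one beyond [P0'] is fixed before [D] and serves the primes with
   [residue_card f p <= C0 * X ^ d]; the one beyond [P1] depends on [D] and serves the others. *)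
have [|P0' tail0] := tail (4 * C%:R)^-1; first by rewrite invr_gt0 mulr_gt0.
pose P0 := maxn P0' (C0 + 2); pose E := P0`!; pose u := E.+1.
pose D := (E ^ (2 * d).+1)%N.
have E2 : (2 <= E)%N by apply: leq_trans (fact_geq _); rewrite /P0; lia.
have Dp : (0 < D)%N by rewrite expn_gt0; lia.
have uD : (u <= D)%N.
  have : (E ^ 2 <= D)%N by rewrite /D leq_exp2l //; lia.
  rewrite /u; nia.
pose DD := ((2 * D) ^ d)%N.
have DDp : (0 < DD)%N by rewrite expn_gt0; lia.
have DDQ : 0 < DD%:R :> rat by rewrite ltr0n.
have [|P1 tail1] := tail (4 * C%:R * DD%:R)^-1.
  by rewrite invr_gt0 !mulr_gt0.
(* As [residue_card f p <= p ^ 2], a prime with [residue_card f p > C0 * X ^ d] exceeds [P1]. The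
   number [Y] bounds the coefficients of every [a c]. *)
pose X := (P1 ^ 2).+1.
pose Y := (2 * D * X)%N.
have XY : (X <= Y)%N by rewrite /Y leq_pmull //; lia.
have XdX : (X <= X ^ d)%N by case: (d) d0 => // k _; rewrite expnS leq_pmulr // expn_gt0.
pose a (c : {ffun 'I_d -> 'I_X}) :=
    u%:Z%:P + D%:Z *: coef_poly_int (fun i => (c i)%:Z).
pose A (p : nat) := [set c | (p %| norm_mod d f (a c))%Z].
pose W := residue_card f.
have D1 : (1 < D)%N by lia.
have congD c : (D %| norm_mod d f (a c) - (u ^ d)%N%:Z)%Z.
  apply: intr_Zp_eq0 => //; rewrite rmorphB /= (map_norm_mod _ _ _ fm).
  have -> : map_poly intr (a c) = (u%:R : 'Z_D)%:P.
    rewrite rmorphD /= map_polyC map_polyZ /= -[X in X *: _]/(D%:R : 'Z_D).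
    by rewrite pchar_Zp // scale0r addr0.
  rewrite norm_mod_const ?monic_map // ?size_map_poly_id0 //.
    by rewrite -[X in _ - X]/((u ^ d)%N%:R : 'Z_D) natrX subrr.
  by rewrite (monicP fm) rmorph1 oner_eq0.
have pD p : prime p -> (P0 < p)%N -> ~~ (p %| D)%N.
  move=> pp; apply: contraL; rewrite /D Euclid_dvdX // => /andP[+ _].
  by rewrite -leqNgt; apply: prime_dvd_fact.
have leY c : (absz (norm_mod d f (a c)) <= C0 * Y ^ d)%N.
  apply: bnd.
    apply: leq_trans (size_polyD _ _) _; rewrite geq_max.
    rewrite (leq_trans (size_polyC_leq1 _)) //=.
    by apply: leq_trans (size_scale_leq _ _) (size_coef_poly_int _).
  move=> i; rewrite coefD coefC coefZ.
  have : (absz ((coef_poly_int (fun i => (c i)%:Z))`_i)%R <= X)%N.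
    by apply: coef_poly_int_le => j; rewrite absz_nat ltnW.
  rewrite /Y; case: (i == 0)%N; nia.
have N0 c : norm_mod d f (a c) != 0.
  apply/eqP=> N0; have := congD c; rewrite N0 sub0r dvdzE abszN absz_nat /D.
  have ud : (0 < u ^ d)%N by rewrite expn_gt0.
  have uE : coprime u E by rewrite /u coprimeSn.
  move=> DN; have: coprime D D by apply: coprime_dvdr DN _; rewrite /D coprimeXl // coprimeXr // coprime_sym.
  by rewrite /coprime gcdnn; lia.
pose L := [seq p <- iota 0 (C0 * Y ^ d).+1 | prime p && (P0 < p)%N].
have Lp p : p \in L -> prime p /\ (P0 < p)%N.
  by rewrite mem_filter => /andP[/andP[]].
have cardA p : p \in L -> (#|A p|%:R : rat) <=
    (C * X ^ d)%:R * ((W p)%:R^-1 * (W p <= C0 * X ^ d)%N%:R) +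
    (C * DD * X ^ d)%:R * ((W p)%:R^-1 * (C0 * X ^ d < W p)%N%:R).
  move=> /Lp [pp P0p].
  have C0p' : (C0 < p)%N by move: P0p; rewrite /P0; lia.
  have WQ : 0 < (W p)%:R :> rat by rewrite ltr0n residue_card_gt0 // prime_gt0.
  have card Z (XZ : (X <= Z)%N) := @card_norm_dvd f d C0 u D X Z p fm sf irr d0 C0p bnd pp C0p' (pD p pp P0p) XZ.
  case: leqP => /= WX; rewrite ?mulr1 ?mulr0 ?addr0 ?add0r.
    have [/(_ WX) + _] := card X (leqnn _).
    rewrite ler_pdivlMr // -natrM ler_nat => h; apply: leq_trans h _.
    by rewrite /C !mulnA.
  have [h1 h2] := card Y XY; rewrite ler_pdivlMr // -natrM ler_nat.
  (* If [A p] is nonempty, [residue_card f p] divides a nonzero norm, hence is at most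
     [C0 * Y ^ d]. *)
  have [->|[c cA]] := set_0Vmem (A p); first by rewrite cards0 mul0n.
  have WY : (residue_card f p <= C0 * Y ^ d)%N.
    apply: leq_trans (leY c); move: (h2 c cA); rewrite dvdzE.
    by rewrite absz_nat; apply: dvdn_leq; rewrite absz_gt0; apply: N0.
  apply: leq_trans (h1 WY) _.
  by rewrite /C /DD /Y !expnMn !mulnA.
have cov : (#|{ffun 'I_d -> 'I_X}| <= \sum_(p <- L) #|A p|)%N.
  apply: union_bound => c.
  have P02 : (2 <= P0)%N by rewrite /P0; lia.
  have [p [pp pP pN]] := prime_factor_of_congruence d0 P02 (congD c).
  apply/hasP; exists p; last by rewrite inE.
  rewrite mem_filter pp pP mem_iota /= ltnS; apply: leq_trans (leY c).
  by move: pN; rewrite dvdzE absz_nat; apply: dvdn_leq; rewrite absz_gt0; apply: N0.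
have sumb (b : pred nat) (P : nat) eps :
    (forall S, uniq S -> (forall p, p \in S -> prime p /\ (P < p)%N) ->
      \sum_(p <- S) ((W p)%:R)^-1 <= eps :> rat) ->
    (forall p, p \in L -> b p -> (P < p)%N) ->
    \sum_(p <- L) ((W p)%:R^-1 * (b p)%:R) <= eps :> rat.
  move=> le bP; rewrite (eq_bigr (fun p => if b p then ((W p)%:R)^-1 else 0)).
    rewrite -big_mkcond -big_filter; apply: le.
      by rewrite !filter_uniq // iota_uniq.
    by move=> p; rewrite mem_filter => /andP[bp pL]; have [pp _] := Lp p pL; split; rewrite ?bP.
  by move=> p _; case: (b p); rewrite ?mulr1 ?mulr0.
have S1 := sumb (fun p => (W p <= C0 * X ^ d)%N) P0' _ tail0.
have S2 := sumb (fun p => (C0 * X ^ d < W p)%N) P1 _ tail1.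
have {}S1 := S1 (fun p pL _ => leq_ltn_trans (leq_maxl _ _) (Lp p pL).2).
have {}S2 : \sum_(p <- L) ((W p)%:R^-1 * (C0 * X ^ d < W p)%N%:R) <=
    (4 * C%:R * DD%:R)^-1 :> rat.
  apply: S2 => p /Lp[pp _] WX; rewrite ltnNge; apply/negP=> pP1.
  have: (W p <= p ^ 2)%N.
    by rewrite /W /residue_card; case: ifP => // _; rewrite leq_exp2l ?prime_gt1.
  have: (p ^ 2 <= P1 ^ 2)%N by rewrite leq_exp2r.
  have: (X ^ d <= C0 * X ^ d)%N by rewrite leq_pmull.
  rewrite -/X in XdX; move: XdX WX; rewrite {1}/X; lia.
have XQ : 0 < (X ^ d)%:R :> rat by rewrite ltr0n expn_gt0.
have: ((X ^ d)%:R : rat) <= (C * X ^ d)%:R * (4 * C%:R)^-1 +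
    (C * DD * X ^ d)%:R * (4 * C%:R * DD%:R)^-1.
  have := cov; rewrite card_ffun !card_ord -(ler_nat rat) => /le_trans; apply.
  rewrite natr_sum big_seq; apply: le_trans (ler_sum _ cardA) _.
  rewrite -big_seq big_split /= -!mulr_sumr.
  by apply: lerD; apply: ler_wpM2l.
rewrite [(C * DD * _)%:R]natrM [(C * DD)%:R]natrM [(C * _)%:R]natrM.
move: (C%:R) (DD%:R) (X ^ d)%:R CQ DDQ XQ => x y z x0 y0 z0 {cardA}.
have -> : x * z / (4 * x) = z / 4 by field; rewrite lt0r_neq0.
have -> : x * y * z / (4 * x * y) = z / 4 by field; rewrite !lt0r_neq0.
by lra.
Qed.

(** Otherwise blocks of weight above [eps], each beyond the previous ones, could be concatenated
    until the total exceeds [B]. *)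
Lemma summable_tail_of_bounded (Q : pred nat) (w : nat -> rat) (B : rat) :
  (forall S, uniq S -> (forall p, p \in S -> Q p) -> \sum_(p <- S) w p <= B) ->
  summable_tail Q w.
Proof.
move=> bnd eps eps0; apply: NNPP => nex.
have step P : exists S, [/\ uniq S, forall p, p \in S -> Q p /\ (P < p)%N
    & eps < \sum_(p <- S) w p].
  apply: NNPP => nS; apply: nex; exists P => S uS QS; rewrite leNgt.
  by apply/negP => lt; apply: nS; exists S.
have iter (n : nat) : exists S, [/\ uniq S, forall p, p \in S -> Q p
    & n%:R * eps <= \sum_(p <- S) w p].
  elim: n => [|n [S [uS QS wS]]].
    by exists [::]; rewrite big_nil mul0r.
  have [S' [uS' QS' wS']] := step (\max_(p <- S) p).
  exists (S ++ S'); split; last by rewrite big_cat /= -natr1; lra.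
    rewrite cat_uniq uS uS' andbT; apply/hasPn => p /QS'[_ lt] /=.
    apply/negP => pS; move: lt; rewrite ltnNge => /negP; apply.
    exact: leq_bigmax_seq.
  by move=> p; rewrite mem_cat => /orP[/QS //|/QS'[]].
have [n lt] : exists n : nat, B < n%:R * eps.
  exists (Num.bound `|B / eps|); rewrite -ltr_pdivrMr //.
  apply: le_lt_trans (ler_norm _) _; exact: archi_boundP (normr_ge0 _).
have [S [uS QS wS]] := iter n.
by have := le_lt_trans (le_trans wS (bnd S uS QS)) lt; rewrite ltxx.
Qed.

Lemma sum_uniq_le_iota (w : nat -> rat) (S : seq nat) (M : nat) :
  (forall p, 0 <= w p) -> uniq S -> (forall p, p \in S -> (p < M)%N) ->
  \sum_(p <- S) w p <= \sum_(p <- iota 0 M) w p.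
Proof.
move=> w0 uS SM.
rewrite (perm_big [seq p <- iota 0 M | p \in S]) /=; last first.
  apply: uniq_perm; rewrite ?filter_uniq ?iota_uniq // => p.
  by rewrite mem_filter mem_iota /=; case: (boolP (p \in S)) => // /SM ->.
rewrite big_filter [leRHS](bigID (fun p => p \in S)) /= lerDl.
exact: sumr_ge0.
Qed.

Lemma sum_inv_sq_le (M : nat) :
  \sum_(p <- iota 0 M.+2) (p%:R ^+ 2)^-1 <= 2 - (M.+1%:R)^-1 :> rat.
Proof.
elim: M => [|M IH].
  (* The term at 0 vanishes because the inverse of 0 is 0. *)
  by rewrite big_cons big_seq1 expr0n invr0 expr1n invr1 add0r.
rewrite -addn1 iotaD big_cat big_seq1 add0n /=.
apply: le_trans (lerD IH (lexx _)) _.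
have x0 : 0 < M.+1%:R :> rat by rewrite ltr0n.
rewrite -[M.+2%:R]natr1; move: M.+1%:R x0 => x x0.
rewrite -subr_ge0.
have -> : 2 - (x + 1)^-1 - (2 - x^-1 + ((x + 1) ^+ 2)^-1) =
   (x * (x + 1) ^+ 2)^-1 by field; rewrite !lt0r_neq0 //; lra.
by rewrite invr_ge0 mulr_ge0 ?exprn_ge0 //; lra.
Qed.

(** In the divergent series of [residue_card_not_summable], the primes without a root contribute
    only inverse squares. *)
Lemma sum_inv_primes_with_root_unbounded (f : {poly int}) (d P : nat) (B : rat) :
  f \is monic -> size f = d.+1 -> irreducible_poly f -> (0 < d)%N ->
  exists S, [/\ uniq S,
    forall p, p \in S -> [/\ prime p, (P < p)%N & has_root_Fp f p]
  & B < \sum_(p <- S) (p%:R)^-1].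
Proof.
move=> fm sf irr d0; apply: NNPP => nS.
have bnd S : uniq S -> (forall p, p \in S -> [/\ prime p, (P < p)%N & has_root_Fp f p]) ->
    \sum_(p <- S) (p%:R)^-1 <= B.
  by move=> uS QS; rewrite leNgt; apply/negP => lt; apply: nS; exists S.
apply: (residue_card_not_summable fm sf irr d0).
(* [B] accounts for the primes above [P] with a root, [P.+1] for the primes up to [P], and [2] for
   the inverse squares. *)
apply: (@summable_tail_of_bounded _ _ (B + P.+1%:R + 2)) => S uS QS.
pose b1 p := has_root_Fp f p && (P < p)%N.
have b0 (b : bool) : 0 <= b%:R :> rat by case: b.
have iv0 (n : nat) : 0 <= (n%:R)^-1 :> rat by rewrite invr_ge0 ler0n.
have le_w p : prime p -> ((residue_card f p)%:R^-1 : rat) <=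
   (if b1 p then (p%:R)^-1 else 0) + (p < P.+1)%N%:R + (p%:R ^+ 2)^-1.
  move=> pp; have p1 : 1 <= p%:R :> rat by rewrite ler1n prime_gt0.
  have sq0 : 0 <= (p%:R ^+ 2)^-1 :> rat by rewrite invr_ge0 exprn_ge0 ?ler0n.
  rewrite /residue_card /b1; case: ifP => _ /=; last first.
    by rewrite natrX add0r lerDr.
  rewrite expn1 ltnS; case: ltnP => _ /=; rewrite ?addr0 ?add0r.
    by rewrite lerDl.
  by apply: ler_wpDr => //; rewrite invf_le1 //; lra.
rewrite big_seq; apply: le_trans (ler_sum _ (fun p pS => le_w p (QS p pS))) _.
rewrite -big_seq !big_split /=; apply: lerD; first apply: lerD.
- rewrite -big_mkcond -big_filter; apply: bnd; first by rewrite filter_uniq.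
  by move=> p; rewrite mem_filter => /andP[/andP[-> ->] /QS].
- rewrite -natr_sum ler_nat.
  rewrite -big_mkcond /= sum1_count -size_filter -[leqRHS](size_iota 0).
  apply: uniq_leq_size; first by rewrite filter_uniq.
  by move=> p; rewrite mem_filter mem_iota /= => /andP[].
pose M := \max_(p <- S) p.
apply: le_trans (sum_uniq_le_iota (M := M.+2) _ uS _) _.
- by move=> p; rewrite invr_ge0 exprn_ge0 ?ler0n.
- by move=> p pS; rewrite ltnS leqW // leq_bigmax_seq.
by apply: le_trans (sum_inv_sq_le M) _; rewrite gerBl.
Qed.

(** * Convergence over the primes with two roots *)

Lemma dvdz_horner_sub (f : {poly int}) (x y : int) : (x - y %| f.[x] - f.[y])%Z.
Proof.
have: root (f - f.[y]%:P) y by rewrite /root !hornerE subrr.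
case/factor_theorem=> u /(congr1 (fun g => g.[x])); rewrite !hornerE => ->.
exact: dvdz_mull.
Qed.

Definition hensel_above (N : nat) (f : {poly int}) : Prop :=
  forall p, prime p -> (N < p)%N -> forall x : int, (p %| f.[x])%Z ->
  forall v : nat, exists2 y : int, (p %| y - x)%Z & ((p ^ v)%N %| f.[y])%Z.

(** Strong induction on [n]: the part of [n] at its smallest prime is treated by Hensel lifting and
    the cofactor by induction; the Chinese remainder theorem glues the two roots. *)
Lemma crt_root (f : {poly int}) (N : nat) (r : nat -> int) (n : nat) :
  hensel_above N f -> (0 < n)%N ->
  (forall p, prime p -> (p %| n)%N -> (N < p)%N /\ (p %| f.[r p])%Z) ->
  exists2 x : int, (n %| f.[x])%Z &
    forall p, prime p -> (p %| n)%N -> (p %| x - r p)%Z.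
Proof.
move=> hens; elim/ltn_ind: n => n IH n0 rn.
have [n1|n1] := leqP n 1.
  exists 0; first by rewrite (_ : n = 1%N) ?dvd1z //; lia.
  move=> p pp; rewrite (_ : n = 1%N); last by lia.
  by rewrite Euclid_dvd1.
have pp := pdiv_prime n1; set p := pdiv n in pp.
have pn : (p %| n)%N := pdiv_dvd n.
have nE := partnC p n0.
have co : coprime (n`_p)%N (n`_p^')%N by apply: coprime_partC.
have part_p : (n`_p = p ^ logn p n)%N := p_part p n.
have v0 : (0 < logn p n)%N by rewrite logn_gt0 mem_primes pp n0.
have m0 : (0 < n`_p^')%N := part_gt0 _ _.
move: (n`_p)%N (n`_p^')%N nE co part_p m0 => k m nE co part_p m0.
have k1 : (1 < k)%N by rewrite part_p -{1}(exp1n (logn p n)) ltn_exp2r // prime_gt1.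
have lt : (m < n)%N by rewrite -nE ltn_Pmull.
have sub l : (l %| m)%N -> (l %| n)%N by move=> lm; rewrite -nE dvdn_mull.
have [x' x'f x'r] := IH _ lt m0 (fun l lp lm => rn l lp (sub l lm)).
have [Np rp] := rn p pp pn.
have [y yx yf] := hens p pp Np _ rp (logn p n).
rewrite -part_p in yf.
have coz : coprimez k m by rewrite coprimezE.
pose x := zchinese k m y x'.
have xk : (k %| x - y)%Z by rewrite -eqz_mod_dvd; apply/eqP/zchinese_modl.
have xm : (m %| x - x')%Z by rewrite -eqz_mod_dvd; apply/eqP/zchinese_modr.
have fsub (a : nat) (u w : int) : (a %| u - w)%Z -> (a %| f.[w])%Z -> (a %| f.[u])%Z.
  move=> uw fw; rewrite -[f.[u]](subrK f.[w]) rpredD //.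
  exact: dvdz_trans uw (dvdz_horner_sub f u w).
exists x.
  by rewrite -nE PoszM Gauss_dvdz // (fsub _ _ _ xk yf) (fsub _ _ _ xm x'f).
move=> l lp; rewrite -nE Euclid_dvdM // => /orP[].
  rewrite part_p Euclid_dvdX // => /andP[+ _]; rewrite dvdn_prime2 // => /eqP ->.
  rewrite (_ : x - r p = (x - y) + (y - r p)); last by ring.
  rewrite rpredD //; apply: dvdz_trans xk.
  by rewrite dvdzE /= part_p -(prednK v0) expnS dvdn_mulr.
move=> lm; rewrite (_ : x - r l = (x - x') + (x' - r l)); last by ring.
by rewrite rpredD ?x'r //; apply: dvdz_trans xm.
Qed.

(** The code of an element is given by a relation, which spares the choice of a coding function. *)
Lemma size_le_card_of_inj_rel (I : eqType) (T : finType) (R : I -> T -> Prop) (s : seq I) :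
  uniq s -> (forall x, x \in s -> exists c, R x c) ->
  (forall x y c, x \in s -> y \in s -> R x c -> R y c -> x = y) ->
  (size s <= #|T|)%N.
Proof.
move=> us ex inj.
suff [cs [scs ucs _]] : exists cs : seq T, [/\ size cs = size s, uniq cs &
    forall c, c \in cs -> exists2 x, x \in s & R x c].
  by rewrite -scs; apply: leq_trans (max_card (mem cs)); rewrite (card_uniqP ucs).
elim: s us ex inj => [|x s IH] /=; first by exists [::].
move=> /andP[xs us] ex inj.
have [||cs [scs ucs csP]] := IH us.
- by move=> y ys; apply: ex; rewrite inE ys orbT.
- by move=> y z c ys zs; apply: inj; rewrite inE ?ys ?zs orbT.
have [c Rc] := ex x (mem_head _ _).
exists (c :: cs); split=> /=; first by rewrite scs.
  rewrite ucs andbT; apply/negP=> /csP[y ys Ry].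
  have xy : x = y by apply: inj Rc Ry; rewrite ?mem_head // inE ys orbT.
  by rewrite xy ys in xs.
move=> c'; rewrite inE => /orP[/eqP->|/csP[y ys Ry]].
  by exists x; rewrite ?mem_head.
by exists y; rewrite // inE ys orbT.
Qed.

(** More than [n] vectors have entries from [0] to [M], so two of them agree at [x] modulo [n].
    Their difference has entries from [-M] to [M], stored with a shift by [M]. *)
Lemma pigeonhole_poly (d M n : nat) (x : int) :
  (0 < n)%N -> (0 < d)%N -> (n <= M ^ d)%N ->
  exists e : {ffun 'I_d -> 'I_(2 * M).+1},
    let a := coef_poly_int (fun j => (e j)%:Z - M%:Z) in
    a != 0 /\ (n %| a.[x])%Z.
Proof.
move=> n0 d0 nM.
pose pol (c : {ffun 'I_d -> 'I_M.+1}) := coef_poly_int (fun j => (c j)%:Z).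
pose g (c : {ffun 'I_d -> 'I_M.+1}) : 'I_n.-1.+1 := inord `|((pol c).[x] %% n)%Z|.
have : ~~ injectiveb g.
  apply/negP=> /injectiveP /leq_card; rewrite card_ffun !card_ord prednK //.
  by apply/negP; rewrite -ltnNge; apply: leq_ltn_trans nM _; rewrite ltn_exp2r.
case/injectivePn=> c [c' ne gE].
have nz : n%:Z != 0 by rewrite eqz_nat -lt0n.
have mod_lt (y : int) : (`|(y %% n)%Z| < n.-1.+1)%N.
  by rewrite prednK //; have := ltz_mod y nz; have := modz_ge0 y nz; lia.
have {gE} : ((pol c).[x] %% n)%Z = ((pol c').[x] %% n)%Z.
  move: gE => /(congr1 val); rewrite /= !inordK //.
  by have := modz_ge0 (pol c).[x] nz; have := modz_ge0 (pol c').[x] nz; lia.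
move/eqP; rewrite eqz_mod_dvd -hornerN -hornerD coef_poly_intB => dv.
exists [ffun j => inord (c j + M - c' j)].
have lt j : (c j + M - c' j < (2 * M).+1)%N.
  by have := ltn_ord (c j); have := ltn_ord (c' j); lia.
rewrite /= (_ : coef_poly_int _ = coef_poly_int (fun j => (c j)%:Z - (c' j)%:Z)).
  split=> //; apply: contraNneq ne => a0; apply/eqP/ffunP => j; apply: val_inj.
  by have /eqP := coef_poly_int_eq0 a0 j; rewrite subr_eq0 => /eqP[].
congr rVpoly; apply/rowP=> j; rewrite !mxE ffunE inordK ?lt //.
have := leq_ord (c j); have := leq_ord (c' j).
by move: (nat_of_ord (c j)) (nat_of_ord (c' j)) => u w uM wM; lia.
Qed.

(** For boolean predicates [xchoose] supplies the witnesses, so no axiom of choice enters. *)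
Lemma bool_countable_choice (T : choiceType) (Q : nat -> pred T) :
  (forall n, exists x, Q n x) -> exists r : nat -> T, forall n, Q n (r n).
Proof. by move=> ex; exists (fun n => xchoose (ex n)) => n; apply: xchooseP. Qed.

Definition two_roots (f : {poly int}) (p : nat) : Prop :=
  exists x y : int,
    [/\ (p %| f.[x])%Z, (p %| f.[y])%Z & ~~ (p %| x - y)%Z].

(* A pair [(n, x)] with [n] dividing [f.[x]] is encoded by a short vector [a] of
   the lattice [{a | n divides a.[x]}]: as [norm a = n * t] with [t] bounded,
   [a] and [t] determine [n], and [x] modulo [p] for every [p] not dividing [t].
   A prime [p] with two roots allows one to change [x] modulo [p], so many such
   primes would give too many pairs. *)
Lemma sum_inv_primes_two_roots_bounded (f : {poly int}) (d N : nat) :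
  f \is monic -> size f = d.+1 -> irreducible_poly f -> (1 < d)%N ->
  hensel_above N f ->
  (forall p, prime p -> (N < p)%N -> exists x : int, (p %| f.[x])%Z) ->
  exists (P : nat) (B : rat), forall S, uniq S ->
    (forall p, p \in S -> [/\ prime p, (P < p)%N & two_roots f p]) ->
    \sum_(p <- S) (p%:R)^-1 <= B.
Proof.
move=> fm sf irr d1 hens rt.
have d0 : (0 < d)%N by apply: ltnW.
have [C0 C0p bnd] := norm_mod_le fm sf.
(* A number congruent to 1 modulo [D] has only prime factors above [P]: these admit Hensel lifting
   and exceed the bound [8 * C0] on the cofactors [t]. *)
pose P := maxn N (8 * C0); pose D := P`!.
have D0 : (0 < D)%N by apply: fact_gt0.
pose C1 := (3 ^ d * (8 * C0).+1)%N.
exists P, (4 * D%:R * (C1.+1)%:R) => S uS SP.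
have [r0 r0P] : exists r0 : nat -> int, forall p, (prime p && (N < p)%N) ==> (p %| f.[r0 p])%Z.
  apply: (@bool_countable_choice int (fun p x => (prime p && (N < p)%N) ==> (p %| f.[x])%Z)) => p.
  by case: (boolP (prime p && _)) => [/andP[pp Np]|_]; [exact: rt|exists 0].
have [r1 r1P] : exists r1 : nat -> int, forall p, (p \in S) ==>
    ((p %| f.[r1 p])%Z && ~~ (p %| r1 p - r0 p)%Z).
  apply: (@bool_countable_choice int (fun p x => (p \in S) ==>
    ((p %| f.[x])%Z && ~~ (p %| x - r0 p)%Z))) => p.
  case: (boolP (p \in S)) => [pS|_]; last by exists 0.
  have [_ _ [x [y [fx fy xy]]]] := SP p pS.
  have [px|px] := boolP (p %| x - r0 p)%Z; last by exists x; rewrite fx px.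
  exists y; rewrite fy /=; apply: contra xy => py.
  have -> : x - y = (x - r0 p) - (y - r0 p) by rewrite opprB addrA subrK.
  exact: rpredB.
(* This makes [Z] at least [8 * p * D] for every [p] in [S], and at least [size S], which absorbs
   the rounding in [J]. *)
pose M := (8 * D * (\sum_(p <- S) p) + size S).+1.
pose Z := (M ^ d)%N.
have MZ : (M <= Z)%N by rewrite /Z; case: (d) d0 => // k _; rewrite expnS leq_pmulr // expn_gt0.
pose J p := (Z %/ (4 * p * D))%N.
have SZ p : p \in S -> (8 * p * D <= Z)%N.
  move=> pS; apply: leq_trans MZ.
  have : (p <= \sum_(p <- S) p)%N by rewrite (big_rem p pS) leq_addr.
  rewrite /M; nia.
(* The pair [(p, i)] stands for the modulus [p * (D * (J p + i) + 1)], of size between [Z / 8] and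
   [Z]. The prime [p] is marked: the root attached to the pair reduces to [r1 p] there and to [r0 l]
   at the other primes [l]. *)
pose num (x : nat * nat) := (x.1 * (D * (J x.1 + x.2)).+1)%N.
pose s := [seq (p, i) | p <- S, i <- iota 0 (J p)].
have us : uniq s.
  apply: allpairs_uniq_dep => // [p _|[p i] [q j] _ _ /= [-> ->]] //.
  exact: iota_uniq.
have memS x : x \in s -> x.1 \in S /\ (x.2 < J x.1)%N.
  by case/allpairsPdep => p [i [pS]]; rewrite mem_iota => iJ ->.
have pprop p : p \in S -> [/\ prime p, (N < p)%N & (8 * C0 < p)%N].
  by move=> /SP[pp Pp _]; split=> //; move: Pp; rewrite /P; lia.
have num_bounds x : x \in s -> [/\ (0 < num x)%N, (num x <= Z)%N & (Z <= 8 * num x)%N].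
  move=> /memS[pS iJ]; have := SZ _ pS; have [/prime_gt0 p0 _ _] := pprop _ pS.
  have q0 : (0 < 4 * x.1 * D)%N by rewrite !muln_gt0 p0.
  have := leq_trunc_div Z (4 * x.1 * D); have := ltn_ceil Z q0.
  rewrite /num -/(J x.1); move: x.1 x.2 (J x.1) iJ p0 {pS q0} => p i j iJ p0 h1 h2 h3.
  have e1 : (p * D * i.+1 <= p * D * j)%N by rewrite leq_mul2l iJ orbT.
  split; nia.
have num_prime x l : x \in s -> prime l -> (l %| num x)%N -> (N < l)%N /\ (8 * C0 < l)%N.
  move=> /memS[pS _] lp; rewrite Euclid_dvdM // => /orP[].
    have [pp ? ?] := pprop _ pS; by rewrite dvdn_prime2 // => /eqP ->.
  move=> lD; suff : (P < l)%N by rewrite /P; lia.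
  rewrite ltnNge; apply/negP => lP.
  have lD' : (l %| D)%N by rewrite dvdn_fact // prime_gt0.
  by move: lD; rewrite -addn1 dvdn_addr ?Euclid_dvd1 // dvdn_mulr.
pose vec (e : {ffun 'I_d -> 'I_(2 * M).+1}) := coef_poly_int (fun j => (e j)%:Z - M%:Z).
pose R (x : nat * nat) (c : {ffun 'I_d -> 'I_(2 * M).+1} * 'I_(8 * C0).+1) :=
  [/\ norm_mod d f (vec c.1) != 0,
      (num x * c.2)%N = `|norm_mod d f (vec c.1)|%N &
      exists y : int, [/\ (num x %| f.[y])%Z, (num x %| (vec c.1).[y])%Z,
        (x.1 %| y - r1 x.1)%Z &
        forall l, prime l -> (l %| num x)%N -> l != x.1 -> (l %| y - r0 l)%Z]].
have le_s : (size s <= #|{: {ffun 'I_d -> 'I_(2 * M).+1} * 'I_(8 * C0).+1}|)%N.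
  apply: (size_le_card_of_inj_rel (R := R) us).
    move=> x xs; have [n0 nZ Zn] := num_bounds x xs; have [pS iJ] := memS x xs.
    pose r l := if l == x.1 then r1 l else r0 l.
    have rP l : prime l -> (l %| num x)%N -> (N < l)%N /\ (l %| f.[r l])%Z.
      move=> lp ln; have [Nl _] := num_prime x l xs lp ln; split=> //.
      rewrite /r; case: eqP => [->|_]; first by have := r1P x.1; rewrite pS => /andP[].
      by have := r0P l; rewrite lp Nl.
    have [y yf yr] := crt_root hens n0 rP.
    have [e [a0 ay]] := pigeonhole_poly y n0 d0 nZ; rewrite -/(vec e) in a0 ay.
    have nm0 : norm_mod d f (vec e) != 0.
      by apply: norm_mod_int_neq0; rewrite ?size_coef_poly_int.
    have nd : (num x %| `|norm_mod d f (vec e)|)%N.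
      by have := norm_mod_root fm sf d0 yf ay; rewrite dvdzE.
    have le_n : (`|norm_mod d f (vec e)| <= C0 * Z)%N.
      apply: bnd; first exact: size_coef_poly_int.
      move=> i; apply: coef_poly_int_le => j.
      by have := leq_ord (e j); move: (nat_of_ord (e j)) => u; lia.
    have tlt : (`|norm_mod d f (vec e)| %/ num x < (8 * C0).+1)%N.
      rewrite ltnS leq_divLR //; apply: leq_trans le_n _; nia.
    exists (e, Ordinal tlt); split=> //=; first by rewrite mulnC divnK.
    exists y; split=> //.
      by have := yr x.1; rewrite /r eqxx; apply; [have [] := pprop _ pS|rewrite dvdn_mulr].
    by move=> l lp ln lx; have := yr l lp ln; rewrite /r (negPf lx).
  (* Equal codes give equal moduli. If the marked primes differ, [u] and [w] are common roots of [f]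
     and of the vector modulo the full power [k] of [p] in the modulus, and they are distinct modulo
     [p]. So [k ^ 2] divides [num x * t], and [p] divides [t], against [0 < t <= 8 * C0 < p]. *)
  move=> x y [e t] xs ys [/= nm0 xt [u [uf ue ur1 _]]] [_ /= yt [w [wf we _ wr0]]].
  have [pS _] := memS x xs; have [pp Np Cp] := pprop _ pS.
  have t0 : (0 < t)%N.
    rewrite lt0n; apply: contraNneq nm0 => t0; rewrite -absz_eq0 -xt t0 muln0 //.
  have xy : num x = num y by apply/eqP; rewrite -(eqn_pmul2r t0) xt yt.
  have [n0 _ _] := num_bounds x xs.
  have [p1|p1] := eqVneq x.1 y.1.
    move: xy; rewrite /num -p1 => /eqP; rewrite eqn_pmul2l ?prime_gt0 // eqSS.
    rewrite eqn_pmul2l // eqn_add2l => /eqP p2.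
    by rewrite [x]surjective_pairing [y]surjective_pairing p1 p2.
  exfalso; set p := x.1 in pS pp Np Cp ur1 p1.
  have px : (p %| num x)%N by rewrite dvdn_mulr.
  have {}wr0 : (p %| w - r0 p)%Z by apply: wr0; rewrite -?xy.
  have uw : ~~ (p %| w - u)%Z.
    have := r1P p; rewrite pS /= => /andP[_]; apply: contra => pwu.
    have -> : r1 p - r0 p = (w - r0 p) - (w - u) - (u - r1 p) by ring.
    by apply: rpredB => //; apply: rpredB.
  have [m pm nE] := pfactor_coprime pp n0; set k := (p ^ _)%N in nE.
  have kn : (k%:Z %| (num x)%:Z)%Z by rewrite dvdzE /= [X in (_ %| X)%N]nE dvdn_mull.
  have cop : coprimez k (w - u).
    by rewrite coprimezE /= coprimeXl // prime_coprime // -(dvdzE p).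
  have kn' : (k%:Z %| (num y)%:Z)%Z by rewrite -xy.
  have := norm_mod_root2 fm sf d1 cop (dvdz_trans kn uf)
    (dvdz_trans kn' wf) (dvdz_trans kn ue) (dvdz_trans kn' we).
  rewrite dvdzE abszX -xt /= [num x]nE expnS expn1 mulnAC dvdn_pmul2r ?expn_gt0 ?prime_gt0 //.
  move=> kmt; have: (p %| m * t)%N.
    apply: dvdn_trans kmt; rewrite /k -{1}(expn1 p) dvdn_exp2l //.
    by rewrite logn_gt0 mem_primes pp n0.
  rewrite Gauss_dvdr // => /dvdn_leq; rewrite t0 => /(_ isT).
  by move/(leq_trans Cp); rewrite ltnNge leq_ord.
have sizes : size s = (\sum_(p <- S) J p)%N.
  rewrite size_allpairs_dep sumnE big_map; apply: eq_bigr => p _.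
  by rewrite size_iota.
have JS : ((\sum_(p <- S) J p) <= C1 * Z)%N.
  rewrite -sizes; apply: leq_trans le_s _.
  rewrite card_prod card_ffun !card_ord /C1 /Z mulnAC -expnMn leq_mul2r.
  by rewrite leq_exp2r // /M; lia.
have Z0 : 0 < Z%:R :> rat by rewrite ltr0n; apply: leq_trans MZ.
have DQ : 0 < D%:R :> rat by rewrite ltr0n.
(* Rounding costs one unit for each [p], in total [size S <= Z]. *)
have leJ p : p \in S -> Z%:R / (4 * D%:R) * (p%:R)^-1 <= (J p)%:R + 1 :> rat.
  move=> /pprop[/prime_gt0 p0 _ _].
  have pQ : 0 < p%:R :> rat by rewrite ltr0n.
  have q0 : (0 < 4 * p * D)%N by rewrite !muln_gt0 p0.
  have := ltn_ceil Z q0; rewrite -/(J p) -(ltr_nat rat) !natrM -natr1 => h.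
  have -> : Z%:R / (4 * D%:R) / p%:R = Z%:R / (4%:R * p%:R * D%:R) :> rat.
    by field; rewrite !lt0r_neq0.
  by rewrite ler_pdivrMr ?mulr_gt0 // ltW.
have : Z%:R / (4 * D%:R) * (\sum_(p <- S) (p%:R)^-1) <= (C1.+1)%:R * Z%:R :> rat.
  rewrite mulr_sumr big_seq; apply: le_trans (ler_sum _ leJ) _.
  rewrite -big_seq big_split /= -natr_sum big_const_seq count_predT iter_addr_0.
  rewrite -natrD -natrM ler_nat mulSn addnC leq_add //.
  by apply: leq_trans MZ; rewrite /M; apply: leqW; apply: leq_addl.
rewrite -ler_pdivlMl ?divr_gt0 ?mulr_gt0 // => h; apply: le_trans h _.
rewrite le_eqVlt; apply/orP; left; apply/eqP.
by field; rewrite !lt0r_neq0.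
Qed.

(** * Primes modulo which [-2] is not a [q]-th power *)

Definition pow_add2 (q : nat) : {poly int} := 'X^q + 2%:P.

Lemma horner_pow_add2 q x : (pow_add2 q).[x] = x ^+ q + 2.
Proof. by rewrite /pow_add2 !hornerE. Qed.

Lemma size_pow_add2 q : (0 < q)%N -> size (pow_add2 q) = q.+1.
Proof. by move=> q0; rewrite /pow_add2 -[2%:P]opprK -polyCN size_XnsubC. Qed.

Lemma pow_add2_monic q : (0 < q)%N -> pow_add2 q \is monic.
Proof. by move=> q0; rewrite /pow_add2 -[2%:P]opprK -polyCN monicXnsubC. Qed.

Lemma pow_add2_irreducible q : (0 < q)%N -> irreducible_poly (pow_add2 q).
Proof.
move=> q0; have sz := size_pow_add2 q0.
apply: (@eisenstein_crit 2); rewrite ?sz //.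
- by rewrite eqSS -lt0n.
- by rewrite (monicP (pow_add2_monic q0)).
- by rewrite coefD coefXn coefC /= eq_sym gtn_eqF.
move=> i /= iq; rewrite coefD coefXn ltn_eqF // coefC add0r.
by case: (i == 0)%N.
Qed.

(* [((1 + T) ^ q - 1) / T], the shifted [q]-th cyclotomic polynomial. *)
Definition cyclotomic_shift (q : nat) : {poly int} :=
  \poly_(i < q) 'C(q, i.+1)%:Z.

Lemma size_cyclotomic_shift q : (0 < q)%N -> size (cyclotomic_shift q) = q.
Proof. by case: q => // q _; rewrite size_poly_eq //= binn. Qed.

Lemma cyclotomic_shift_monic q : (0 < q)%N -> cyclotomic_shift q \is monic.
Proof.
case: q => // q _; rewrite monicE lead_coefE size_cyclotomic_shift //.
by rewrite coef_poly ltnSn /= binn.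
Qed.

Lemma cyclotomic_shift_irreducible q :
  prime q -> irreducible_poly (cyclotomic_shift q).
Proof.
move=> qp; have q0 := prime_gt0 qp; have q1 := prime_gt1 qp.
apply: (eisenstein_crit qp); rewrite ?size_cyclotomic_shift //.
- by rewrite neq_ltn q1 orbT.
- by rewrite (monicP (cyclotomic_shift_monic q0)) dvdzE /= Euclid_dvd1.
- rewrite coef_poly q0 bin1 dvdzE /=; apply/negP => /dvdn_leq -/(_ q0).
  by rewrite expr2 -[(q * q)%R]/(q * q)%N; nia.
move=> i iq; rewrite coef_poly; case: ltnP => // iq'.
by rewrite dvdzE /= prime_dvd_bin //; lia.
Qed.

Lemma horner_cyclotomic_shift q (s : int) :
  s * (cyclotomic_shift q).[s] = (1 + s) ^+ q - 1.
Proof.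
rewrite horner_poly exprDn big_ord_recl /= subn0 expr1n mul1r expr0 bin0.
rewrite [1 *+ 1 + _]addrC addrK mulr_sumr; apply: eq_bigr => i _.
by rewrite expr1n mul1r /bump /= add1n exprS -mulr_natr natz; ring.
Qed.

Lemma has_root_Fp_int (f : {poly int}) (p : nat) :
  prime p -> has_root_Fp f p -> exists s : int, (p %| f.[s])%Z.
Proof.
move=> pp /existsP[x]; rewrite rootE => /eqP fx; exists (x : nat)%:Z.
rewrite -intr_Fp_eq0 // -horner_map /= -[X in _.[X]]/((x : nat)%:R : 'F_p).
by rewrite natr_Zp fx.
Qed.

Lemma exprDz2 (y h : int) (q : nat) :
  exists r, (y + h) ^+ q = y ^+ q + q%:Z * y ^+ q.-1 * h + h ^+ 2 * r.
Proof.
case: q => [|q]; first by exists 0; rewrite !expr0; ring.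
elim: q => [|q [r IH]]; first by exists 0; rewrite !expr1 expr0; ring.
exists ((y + h) * r + q.+1%:Z * y ^+ q).
rewrite exprS IH /= !exprS -[q.+2%:Z]natz -natr1 natz; ring.
Qed.

(** As [p] divides neither 2 nor [q], a root [y] modulo [p] and the derivative [q * y ^ (q - 1)] are
    units, so each Newton step gains a power of [p]. *)
Lemma hensel_pow_add2 q : prime q -> hensel_above (maxn 2 q) (pow_add2 q).
Proof.
move=> qp p pp pq x; rewrite horner_pow_add2 => px.
elim=> [|v [y yx]].
  by exists x; rewrite ?subrr ?dvdz0 // horner_pow_add2 expn0 dvd1z.
rewrite horner_pow_add2 => yf.
case: v yf => [_|v yf]; first by exists x; rewrite ?subrr ?dvdz0 // horner_pow_add2 expn1.
have p2 : ~~ (p %| 2)%N.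
  by apply/negP=> /dvdn_leq -/(_ isT); rewrite leqNgt (leq_ltn_trans (leq_maxl _ _) pq).
have pq' : ~~ (p %| q)%N.
  apply/negP=> /dvdn_leq -/(_ (prime_gt0 qp)).
  by rewrite leqNgt (leq_ltn_trans (leq_maxr _ _) pq).
have py : ~~ (p %| y)%Z.
  apply: contra p2 => py; have: (p %| (2 : int))%Z.
    have -> : 2 = (y ^+ q + 2) - y ^+ q by ring.
    apply: rpredB; first by apply: dvdz_trans yf; rewrite dvdzE /= expnS dvdn_mulr.
    by rewrite -(prednK (prime_gt0 qp)) exprS dvdz_mulr.
  by rewrite dvdzE.
have cop : coprimez p (q%:Z * y ^+ q.-1).
  rewrite coprimezMr coprimezXr ?andbT; last by rewrite coprimezE prime_coprime // -dvdzE.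
  by rewrite coprimezE /= prime_coprime.
have [[a b] /= ab] := coprimezP _ _ cop.
have [c cE] := dvdzP yf.
have [r rE] := exprDz2 y (- c * b * (p ^ v.+1)%N%:Z) q.
(* Newton's correction: [b] inverts the derivative modulo [p], and [c] is the value at [y] divided
   by [p ^ v.+1]. *)
exists (y + - c * b * (p ^ v.+1)%N%:Z).
  have -> : y + - c * b * (p ^ v.+1)%N%:Z - x = (y - x) + - c * b * (p ^ v.+1)%N%:Z by ring.
  by apply: rpredD => //; apply: dvdz_mull; rewrite dvdzE /= expnS dvdn_mulr.
rewrite horner_pow_add2 rE; set k := (p ^ v.+1)%N%:Z.
have -> : (p ^ v.+2)%N%:Z = p%:Z * k by rewrite expnS PoszM.
have [k' kE] : exists k', k = p%:Z * k' by exists (p ^ v)%N%:Z; rewrite /k expnS PoszM.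
have ab' : b * (q%:Z * y ^+ q.-1) = 1 - a * p by rewrite -ab; ring.
have -> : y ^+ q + q%:Z * y ^+ q.-1 * (- c * b * k) + (- c * b * k) ^+ 2 * r + 2 =
  (y ^+ q + 2) - c * k * (b * (q%:Z * y ^+ q.-1)) + k * k * (c * b) ^+ 2 * r by ring.
rewrite cE -/k ab' {4}kE.
apply/dvdzP; exists (c * a + k' * (c * b) ^+ 2 * r); ring.
Qed.

(** Modulo [p], let [x] be a root of [pow_add2 q] and [s] one of [cyclotomic_shift q]. Then [1 + s]
    is a [q]-th root of unity and [x * (1 + s)] is again a root. It differs from [x] because [p]
    divides neither 2 nor [q], the value of [cyclotomic_shift q] at 0. *)
Lemma infinitely_many_primes_avoid_pow_add2 (q N : nat) : prime q ->
  exists p : nat, [/\ (N < p)%N, prime p & forall x : int, ~~ (p %| x ^+ q + 2)%Z].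
Proof.
move=> qp; apply: NNPP => nex; have q0 := prime_gt0 qp; have q1 := prime_gt1 qp.
pose N' := maxn N (maxn 2 q).
have rt p : prime p -> (N' < p)%N -> exists x : int, (p %| (pow_add2 q).[x])%Z.
  move=> pp Np; apply: NNPP => nx; apply: nex; exists p; split=> //.
    by move: Np; rewrite /N'; lia.
  by move=> x; apply/negP => px; apply: nx; exists x; rewrite horner_pow_add2.
have hens : hensel_above N' (pow_add2 q).
  move=> p pp Np; apply: hensel_pow_add2 => //.
  by move: Np; rewrite /N'; lia.
have [P [B bnd]] := sum_inv_primes_two_roots_bounded (pow_add2_monic q0)
  (size_pow_add2 q0) (pow_add2_irreducible q0) q1 hens rt.
have sz : size (cyclotomic_shift q) = q.-1.+1.
  by rewrite size_cyclotomic_shift // prednK.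
have d0 : (0 < q.-1)%N by lia.
have [S [uS SP]] := sum_inv_primes_with_root_unbounded (maxn P N') B
  (cyclotomic_shift_monic q0) sz (cyclotomic_shift_irreducible qp) d0.
rewrite ltNge => /negP; apply; apply: bnd => // p /SP[pp Pp rp].
have Np : (N' < p)%N by move: Pp; lia.
have pq : (maxn 2 q < p)%N by move: Np; rewrite /N'; lia.
split=> //; first by move: Pp; lia.
have [x px] := rt p pp Np; have [s ps] := has_root_Fp_int pp rp.
exists x, (x * (1 + s)); split=> //.
  rewrite horner_pow_add2 exprMn.
  have -> : (1 + s) ^+ q = s * (cyclotomic_shift q).[s] + 1.
    by rewrite horner_cyclotomic_shift subrK.
  have -> : x ^+ q * (s * (cyclotomic_shift q).[s] + 1) + 2 =
    (x ^+ q * s) * (cyclotomic_shift q).[s] + (x ^+ q + 2) by ring.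
  by apply: rpredD; [apply: dvdz_mull|rewrite -horner_pow_add2].
have -> : x - x * (1 + s) = - (x * s) by ring.
rewrite dvdzE abszN abszM Euclid_dvdM // negb_or; apply/andP; split.
  apply/negP=> px'; have: (p %| (2 : int))%Z.
    have -> : 2 = (pow_add2 q).[x] - x ^+ q by rewrite horner_pow_add2; ring.
    apply: rpredB => //; rewrite -(prednK q0) exprS dvdz_mulr //.
  by rewrite dvdzE => /dvdn_leq -/(_ isT); rewrite leqNgt (leq_ltn_trans (leq_maxl _ _) pq).
apply/negP=> ps'; have: (p %| q%:Z)%Z.
  have -> : q%:Z = (cyclotomic_shift q).[0].
    by rewrite horner_coef0 coef_poly q0 bin1.
  have -> : (cyclotomic_shift q).[0] = (cyclotomic_shift q).[s] -
     ((cyclotomic_shift q).[s] - (cyclotomic_shift q).[0]) by ring.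
  apply: rpredB => //; apply: dvdz_trans (dvdz_horner_sub _ _ _).
  by rewrite subr0 dvdzE.
by rewrite dvdzE => /dvdn_leq -/(_ q0); rewrite leqNgt (leq_ltn_trans (leq_maxr _ _) pq).
Qed.

(** * Values of the form and its order *)

Lemma dvdn_logn_pow_add2 (q p : nat) (a b : int) : (0 < q)%N -> prime p ->
  (forall x : int, ~~ (p %| x ^+ q + 2)%Z) ->
  a ^+ q + 2 * b ^+ q != 0 -> (q %| logn p (absz (a ^+ q + 2 * b ^+ q)%R))%N.
Proof.
move=> q0 pp avoid.
(* The descent divides [a] and [b] by [p], which removes [p ^ q] from the value and lowers the sum
   of absolute values. *)
have [n le_n] : exists n, (`|a| + `|b| < n)%N by exists (`|a| + `|b|).+1%N.
elim: n a b le_n => // n IH a b le_n F0.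
have [pF|pF] := boolP (p %| a ^+ q + 2 * b ^+ q)%Z; last first.
  by rewrite lognE absz_gt0 F0 pp -[(p %| _)%N]/(p%:Z %| _)%Z (negPf pF).
have pb : (p %| b)%Z.
  apply/negPn/negP => pb; have cop : coprimez p b.
    by rewrite coprimezE prime_coprime // -dvdzE.
  have [[u v] /= uv] := coprimezP _ _ cop.
  (* With [v] an inverse of [b] modulo [p], the product [a * v] would be a forbidden root. *)
  have := avoid (a * v); apply/negP; rewrite negbK exprMn.
  have -> : a ^+ q * v ^+ q + 2 = (a ^+ q + 2 * b ^+ q) * v ^+ q
     + 2 * (1 - (v * b) ^+ q) by rewrite exprMn; ring.
  apply: rpredD; first exact: dvdz_mulr.
  apply: dvdz_mull; rewrite -[1](expr1n _ q) subrXX.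
  by apply: dvdz_mulr; rewrite -uv addrK dvdz_mull.
have pa : (p %| a)%Z.
  have: (p %| a ^+ q)%Z.
    have -> : a ^+ q = (a ^+ q + 2 * b ^+ q) - 2 * b ^+ q by ring.
    apply: rpredB => //; apply: dvdz_mull; rewrite -(prednK q0) exprS.
    exact: dvdz_mulr.
  by rewrite !dvdzE abszX Euclid_dvdX // => /andP[].
case/dvdzP: pa => a' aE; case/dvdzP: pb => b' bE.
have FE : a ^+ q + 2 * b ^+ q = p%:Z ^+ q * (a' ^+ q + 2 * b' ^+ q).
  by rewrite aE bE !exprMn; ring.
have F'0 : a' ^+ q + 2 * b' ^+ q != 0.
  by apply: contraNneq F0 => F'0; rewrite FE F'0 mulr0.
have p1 := prime_gt1 pp.
rewrite FE abszM abszX absz_nat lognM ?expn_gt0 ?absz_gt0 ?prime_gt0 // pfactorK //.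
rewrite dvdn_addr // IH //.
have ab0 : (0 < `|a'| + `|b'|)%N.
  rewrite lt0n addn_eq0 !absz_eq0; apply: contraNN F'0 => /andP[/eqP-> /eqP->].
  by rewrite expr0n eqn0Ngt q0 /= mulr0 addr0.
move: le_n; rewrite aE bE !abszM /= -mulnDl ltnS; apply: leq_trans.
by rewrite ltn_Pmulr.
Qed.

Lemma vp_frac (p : nat) (a b : int) : a != 0 -> b != 0 ->
  vp p (a%:~R / b%:~R) = (logn p `|a|)%:Z - (logn p `|b|)%:Z.
Proof.
move=> a0 b0; rewrite /vp; set s := _ / _.
have b0' : b%:~R != 0 :> rat by rewrite intr_eq0.
have s0 : s != 0 by rewrite mulf_neq0 ?invr_eq0 ?intr_eq0.
have e : numq s * b = a * denq s.
  apply: (@intr_inj rat); rewrite !rmorphM /=.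
  rewrite -[in LHS](divfK (_ : (denq s)%:~R != 0 :> rat) (numq s)%:~R).
    by rewrite divq_num_den /s; field.
  by rewrite intr_eq0 denq_eq0.
have := congr1 (fun x : int => logn p `|x|) e.
rewrite !abszM !lognM ?absz_gt0 ?numq_eq0 ?denq_eq0 //; lia.
Qed.

(** If [s - p] has valuation at least 2, then [s] has valuation 1, which is not a multiple of [q].
    In terms of fractions, [a] would have valuation one more than [b]. *)
Lemma not_dense_of_dvd_logn (p q : nat) (A : rat -> Prop) :
  prime p -> (1 < q)%N ->
  (forall s, A s -> exists a b : int, [/\ b != 0, s = a%:~R / b%:~R,
     (a != 0 -> q %| logn p `|a|)%N & (q %| logn p `|b|)%N]) ->
  ~ padic_dense p A.
Proof.
move=> pp q1 AP /(_ p%:R 2)[s [/AP[a [b [b0 sE qa qb]]]]].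
have p0 : p%:Z != 0 by rewrite eqz_nat -lt0n prime_gt0.
have b0' : b%:~R != 0 :> rat by rewrite intr_eq0.
set l := logn p `|b| in qb.
have absurd_l : a != 0 -> logn p `|a| = l.+1 -> False.
  move=> a0 e; have := qa a0; rewrite e -addn1 dvdn_addr // => /dvdn_leq; lia.
have lpb : logn p (absz (p%:Z * b)%R) = l.+1.
  by rewrite abszM lognM ?absz_gt0 // -[X in logn p X]expn1 pfactorK.
case=> [sp|].
  have ab : a = p%:Z * b.
    apply: (@intr_inj rat); rewrite rmorphM /= -[p%:Z%:~R]/(p%:R) -sp sE divfK //.
  by apply: absurd_l; rewrite ab ?mulf_neq0.
have -> : s - p%:R = (a - p%:Z * b)%:~R / b%:~R.
  by rewrite sE rmorphB rmorphM /=; field.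
(* Here [vp] of 0 is 0 and not infinite, so it is not at least 2. *)
have [->|ab0] := eqVneq (a - p%:Z * b) 0.
  by rewrite rmorph0 mul0r /vp (_ : numq 0 = 0) // (_ : denq 0 = 1) // absz0 logn0 logn1.
rewrite vp_frac // -/l => le.
have pd : ((p ^ l.+2)%N%:Z %| a - p%:Z * b)%Z.
  rewrite dvdzE /= pfactor_dvdn // ?absz_gt0 //; lia.
have npb n : ((p ^ n)%N%:Z %| p%:Z * b)%Z = (n <= l.+1)%N.
  by rewrite dvdzE /= pfactor_dvdn ?lpb // absz_gt0 mulf_neq0.
have a0 : a != 0.
  apply: contraL pd => /eqP->; rewrite sub0r dvdzE abszN -dvdzE npb; lia.
have na n : ((p ^ n)%N%:Z %| a)%Z = (n <= logn p `|a|)%N.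
  by rewrite dvdzE /= pfactor_dvdn // absz_gt0.
have pdl : ((p ^ l.+1)%N%:Z %| a - p%:Z * b)%Z.
  by apply: dvdz_trans pd; rewrite dvdzE /= dvdn_exp2l.
apply: absurd_l => //; apply/eqP; rewrite eqn_leq -na; apply/andP; split.
  rewrite leqNgt -na; apply/negP => h.
  have: ((p ^ l.+2)%N%:Z %| p%:Z * b)%Z.
    have -> : p%:Z * b = a - (a - p%:Z * b) by ring.
    exact: rpredB.
  by rewrite npb ltnn.
have -> : a = (a - p%:Z * b) + p%:Z * b by ring.
by apply: rpredD => //; rewrite npb.
Qed.

Lemma meval_formF (m k q : nat) (x : 'I_m.+1 -> int) :
  (formF m k q).@[x] =
  (x ord0 ^+ k) ^+ q + 2 * (\sum_(i < m) x (lift ord0 i) ^+ k) ^+ q.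
Proof.
rewrite /formF mevalD mevalM rmorph_nat !rmorphXn /= mevalXU rmorph_sum /=.
rewrite exprM; congr (_ + _ * _ ^+ _); apply: eq_bigr => i _.
by rewrite rmorphXn /= mevalXU.
Qed.

Lemma meval_map_formF (m k q : nat) (x : 'I_m.+1 -> rat) :
  (map_mpoly (intr : int -> rat) (formF m k q)).@[x] =
  x ord0 ^+ (k * q) + 2 * (\sum_(i < m) x (lift ord0 i) ^+ k) ^+ q.
Proof.
rewrite /formF rmorphD rmorphM rmorph_nat !rmorphXn /= map_mpolyX rmorph_sum /=.
rewrite mevalD mevalM rmorph_nat !rmorphXn /= mevalXU rmorph_sum /=.
congr (_ + _ * _ ^+ _); apply: eq_bigr => i _.
by rewrite !rmorphXn /= map_mpolyX mevalXU.
Qed.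

Lemma poly_eq0_of_horner (p : {poly rat}) : (forall t, p.[t] = 0) -> p = 0.
Proof.
move=> p0; apply/eqP/negPn/negP => nz.
have := max_poly_roots (rs := [seq n%:R | n <- iota 0 (size p)]) nz.
rewrite size_map size_iota ltnn => /(_ _ _)/negP; apply=> //.
  by apply/allP => t _; rewrite rootE p0.
rewrite map_inj_uniq ?iota_uniq // => i j /eqP; by rewrite eqr_nat => /eqP.
Qed.

(* If [F] is invariant under translations along [v], its derivative along [v]
   vanishes; at the basis vectors this derivative is a multiple of the
   coordinates of [v]. *)
Lemma formF_invariant_direction (m k q : nat) (v : 'I_m.+1 -> rat) :
  (1 < k)%N -> (1 < q)%N ->
  (forall (y : 'I_m.+1 -> rat) t,
    (map_mpoly (intr : int -> rat) (formF m k q)).@[fun i => y i + t * v i] =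
    (map_mpoly (intr : int -> rat) (formF m k q)).@[y]) ->
  forall i, v i = 0.
Proof.
move=> k1 q1 inv; have k0 := ltnW k1; have q0 := ltnW q1.
have grad (y : 'I_m.+1 -> rat) :
    (k * q)%:R * (y ord0 ^+ (k * q).-1 * v ord0) +
    2 * (q%:R * ((\sum_(i < m) y (lift ord0 i) ^+ k) ^+ q.-1 *
      \sum_(i < m) k%:R * (y (lift ord0 i) ^+ k.-1 * v (lift ord0 i)))) = 0.
  (* The polynomial [p] is the form restricted to the line through [y] along [v]. It is constant, so
     its derivative at 0 vanishes. *)
  pose l i : {poly rat} := (y i)%:P + v i *: 'X.
  have dl i : (l i)^`() = (v i)%:P by rewrite /l !derivE add0r alg_polyC.
  have hl i t : (l i).[t] = y i + t * v i by rewrite /l !hornerE mulrC.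
  pose p := l ord0 ^+ (k * q) + 2%:P * (\sum_(i < m) l (lift ord0 i) ^+ k) ^+ q.
  have hp t : p.[t] = (map_mpoly (intr : int -> rat) (formF m k q)).@[y].
    rewrite -(inv y t) meval_map_formF /p hornerD hornerM hornerC !horner_exp hl.
    congr (_ + _ * _ ^+ _); rewrite horner_sum; apply: eq_bigr => i _.
    by rewrite horner_exp hl.
  have pc : p = (p.[0])%:P.
    apply/eqP; rewrite -subr_eq0; apply/eqP/poly_eq0_of_horner => t.
    by rewrite hornerD hornerN hornerC !hp subrr.
  have E : p^`().[0] = 0 by rewrite pc derivC horner0.
  rewrite -[RHS]E.
  have dX i n : ((l i ^+ n)^`()).[0] = n%:R * (y i ^+ n.-1 * v i).
    by rewrite deriv_exp dl hornerMn hornerM hornerC horner_exp hl mul0r addr0 -mulr_natl [v i * _]mulrC.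
  rewrite /p derivD derivM derivC mul0r add0r hornerD dX hornerM hornerC.
  congr (_ + _ * _); rewrite deriv_exp hornerMn hornerM horner_exp [LHS]mulr_natl.
  have -> : (\sum_(i < m) l (lift ord0 i) ^+ k)^`().[0] =
      \sum_(i < m) k%:R * (y (lift ord0 i) ^+ k.-1 * v (lift ord0 i)).
    rewrite raddf_sum horner_sum; apply: eq_bigr => i _; exact: dX.
  have -> : (\sum_(i < m) l (lift ord0 i) ^+ k).[0] = \sum_(i < m) y (lift ord0 i) ^+ k.
    by rewrite horner_sum; apply: eq_bigr => i _; rewrite horner_exp hl mul0r addr0.
  by rewrite mulrC.
have nat0 (n : nat) : (0 < n)%N -> n%:R != 0 :> rat by rewrite pnatr_eq0 -lt0n.
have zX n : (0 < n)%N -> 0 ^+ n = 0 :> rat by case: n => // n _; rewrite expr0n.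
(* At the first basis vector the second term of [grad] vanishes because [q > 1]; at each other one,
   [k > 1] isolates a single coordinate of [v]. *)
have v0 : v ord0 = 0.
  have := grad (fun i => (i == ord0)%:R); rewrite eqxx expr1n mul1r.
  rewrite [X in X ^+ q.-1]big1 => [|i _]; last by rewrite zX.
  rewrite zX; last by rewrite -ltnS prednK.
  rewrite mul0r !mulr0 addr0 => /eqP; rewrite mulf_eq0 (negPf (nat0 _ _)) ?muln_gt0 ?k0 //.
  by move/eqP.
move=> i; case: (unliftP ord0 i) => [j|] -> //.
have := grad (fun i => (i == lift ord0 j)%:R); rewrite v0 mulr0 mulr0 add0r.
have e (g : 'I_m -> rat) n : (0 < n)%N ->
    \sum_(i < m) (lift ord0 i == lift ord0 j :> 'I_m.+1)%:R ^+ n * g i = g j.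
  move=> n0; rewrite (bigD1 j) //= eqxx expr1n mul1r big1 ?addr0 // => l lj.
  by rewrite (inj_eq (lift_inj (h := ord0))) (negPf lj) zX // mul0r.
have k1' : (0 < k.-1)%N by rewrite -ltnS prednK.
have -> : \sum_(i < m) (lift ord0 i == lift ord0 j :> 'I_m.+1)%:R ^+ k = 1 :> rat.
  by rewrite -[RHS](e (fun=> 1) k k0); apply: eq_bigr => l _; rewrite mulr1.
rewrite -mulr_sumr (e (fun l => v (lift ord0 l)) k.-1 k1') expr1n mul1r.
move=> /eqP; rewrite mulf_eq0 /= mulf_eq0 (negPf (nat0 _ q0)) /=.
by rewrite mulf_eq0 (negPf (nat0 _ k0)) => /eqP.
Qed.

(** For [i] outside [S], changing the [i]-th variable does not affect the transformed form, so the
    original one is invariant along the [i]-th column of [A]. This column is then zero, against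
    invertibility. *)
Lemma order_formF (m k q : nat) : (1 < k)%N -> (1 < q)%N ->
  order_is (formF m k q) m.+1.
Proof.
move=> k1 q1; split.
  exists 1%:M; split; first exact: unitmx1.
  exists setT; split; first by rewrite cardsT card_ord.
  by move=> mon _ i; rewrite inE.
move=> j [A [Au [S [<- only]]]]; rewrite leqNgt; apply/negP => ltS.
have [i iS] : exists i, i \notin S.
  apply/existsP; rewrite -negb_forall; apply: contraL ltS => /forallP al.
  by rewrite -leqNgt -{1}(card_ord m.+1) -cardsT subset_leq_card //; apply/subsetP.
set G := map_mpoly _ _ in only.
have changeE x : (linear_change A G).@[x] = G.@[fun l => \sum_j A l j * x j].
  rewrite /linear_change comp_mpoly_meval; apply: meval_eq => l.
  rewrite tnth_mktuple raddf_sum /=; apply: eq_bigr => l' _.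
  by rewrite mevalZ mevalXU.
have indep x x' : (forall l, l \in S -> x l = x' l) ->
    (linear_change A G).@[x] = (linear_change A G).@[x'].
  move=> xx'; rewrite !mevalE big_seq [RHS]big_seq; apply: eq_bigr => mon monS.
  congr (_ * _); apply: eq_bigr => l _.
  by have [/xx' -> //|lS] := boolP (l \in S); rewrite (only _ monS) // !expr0.
have Ai0 l0 : A l0 i = 0.
  apply: (formF_invariant_direction k1 q1 (v := fun l => A l i)) => y t.
  pose yc : 'cV[rat]_m.+1 := \col_l y l.
  pose x l := (invmx A *m yc) l ord0.
  have Ax l : \sum_j A l j * x j = y l.
    by have := congr1 (fun M : 'cV_m.+1 => M l ord0) (mulKVmx Au yc); rewrite !mxE.
  pose x' l := x l + t * (l == i)%:R.
  have := indep x' x _; rewrite !changeE => e.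
  rewrite -/G -(meval_eq (v1 := fun l => \sum_j A l j * x j) _ Ax) -e.
    apply: meval_eq => l'; rewrite -Ax /x'.
    under [RHS]eq_bigr => l'' _ do rewrite mulrDr mulrCA.
    rewrite big_split /= -mulr_sumr; congr (_ + _ * _).
    rewrite (bigD1 i) //= eqxx mulr1 big1 ?addr0 // => l'' /negPf ->.
    by rewrite mulr0.
  by move=> l' l'S; rewrite /x' (_ : (l' == i) = false) ?mulr0 ?addr0 //;
     apply: contraNF iS => /eqP <-.
have := congr1 (fun M : 'M_m.+1 => M i i) (mulVmx Au); rewrite !mxE eqxx.
rewrite big1 => [/esym/eqP|l _]; first by rewrite oner_eq0.
by rewrite Ai0 mulr0.
Qed.

Theorem theorem1p5 (n q k m : nat) :
  (1 < n)%N -> ~~ prime n -> prime q -> n = (q * k)%N -> (0 < m)%N ->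
  order_is (formF m k q) m.+1 /\
  (forall N : nat, exists p : nat,
      (N < p)%N /\ prime p /\ ~ padic_dense p (ratio_set (formF m k q))).
Proof.
move=> n1 nprime qp nE m0; have q1 := prime_gt1 qp.
have k1 : (1 < k)%N.
  rewrite ltn_neqAle; apply/andP; split.
    by apply: contraNneq nprime => k1; rewrite nE -k1 muln1.
  by rewrite lt0n; apply: contraTneq n1 => k0; rewrite nE k0 muln0.
split; first exact: order_formF.
move=> N; have [p [Np pp avoid]] := infinitely_many_primes_avoid_pow_add2 N qp.
exists p; split=> //; split=> //; apply: (not_dense_of_dvd_logn pp q1) => s.
case=> x [y [Fy sE]]; exists (formF m k q).@[x], (formF m k q).@[y].
split=> // [Fx|]; rewrite meval_formF; apply: dvdn_logn_pow_add2 => //;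
  by rewrite ?(ltnW q1) // -meval_formF.
Qed.
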